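(* Let $E=\{(\alpha,0,0,\ldots):\alpha\in\mathbb{C}\}\subset c_0$ and let $q\colon c_0\to c_0/E$ be the quotient map. Then there exists a modulus support functional for $q(S_0)$, i.e. there exist a non-zero functional $h\in(c_0/E)^*$ and a point $y\in q(S_0)$ such that $$|h(y)|=\sup_{x\in q(S_0)}|h(x)|.$$
   Context: All spaces are complex; $\mathbb{D}=\{z\in\mathbb{C}:|z|<1\}$. $c_0=c_0(\mathbb{Z}_+)$ is the space of complex sequences $x=(x_j)_{j\ge0}$ tending to zero, with the sup norm. For $\lambda\in\mathbb{D}$ let $\varphi_\lambda=(\lambda^j)_{j\ge0}\in c_0$ (with $0^0=1$). $S_0$ is the closed convex hull in $c_0$ of $\{\varphi_\lambda:\lambda\in\mathbb{D}\}$. The quotient $c_0/E$ is naturally identified with the subspace of $x\in c_0$ with $x_0=0$, and $(c_0/E)^*$ with the space of $a=(a_j)_{j\ge0}\in\ell^1(\mathbb{Z}_+)$ with $a_0=0$, acting by $\langle a,x\rangle=\sum_{j\ge0}a_jx_j$. *)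

(* Defs.v *)
From HB Require Import structures.
From mathcomp Require Import all_boot all_order all_algebra.
From mathcomp Require Import complex.
From mathcomp Require Import all_classical all_reals all_analysis.
Set Implicit Arguments.
Unset Strict Implicit.
Unset Printing Implicit Defensive.
Import Order.TTheory GRing.Theory Num.Theory.
Import numFieldNormedType.Exports.
Import ComplexField Normc.
Local Open Scope classical_set_scope.
Local Open Scope ring_scope.
Local Open Scope complex_scope.

Definition closed_convex_hull (K : numFieldType) (V : normedModType K)
    (B : set V) : set V :=
  smallest
    [set A | closed A /\ convex_set (A : set (convex_lmodType V))] B.

Section CZero.
Variable R : realType.
Local Notation C := (R[i]).

Definition c0_pred : {pred nat -> C^o} :=
  fun x => `[< x @ \oo --> (0 : C^o) >].

Lemma c0_submod_closed : submod_closed c0_pred.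
Proof.
split; first by apply/asboolP; exact: cvg_cst.
move=> a x y /asboolP xc /asboolP yc; apply/asboolP.
have := cvgD (cvgZl_tmp (k := a) xc) yc.
by rewrite scaler0 addr0; apply.
Qed.

HB.instance Definition _ :=
  GRing.isSubmodClosed.Build C (nat -> C^o) c0_pred c0_submod_closed.

Record c0 := C0 { c0_val :> nat -> C^o ; c0_valP : c0_val \in c0_pred }.

HB.instance Definition _ := [isSub for c0_val].
HB.instance Definition _ := [Choice of c0 by <:].
HB.instance Definition _ := [SubChoice_isSubLmodule of c0 by <:].

(* Norms over the scalar field C are C-valued in the library, so the sup norm
   is computed in R and then injected in C. *)
Definition c0_norm (x : c0) : R := sup (range (fun j => normc (x j))).

Lemma c0_has_sup (x : c0) : has_sup (range (fun j => normc (x j))).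
Proof.
split; first by exists (normc (x 0%N)), 0%N.
have /asboolP xc := c0_valP x.
have /cvg_seq_bounded : cvgn (x : nat -> C^o) by apply/cvg_ex; exists 0.
move=> /ex_bound[|M xM]; first exact: (@globally_properfilter _ _ 0%N).
exists (complex.Re M) => _ [j _ <-].
have : `|x j| <= M by exact: xM.
by case: M {xM} => u v; rewrite lecE => /andP[_].
Qed.

Lemma c0_norm_ub (x : c0) j : normc (x j) <= c0_norm x.
Proof. by apply: sup_upper_bound; [exact: c0_has_sup|exists j]. Qed.

Lemma c0_norm_le (x : c0) (M : R) :
  (forall j, normc (x j) <= M) -> c0_norm x <= M.
Proof.
move=> xM; apply: ge_sup; first by exists (normc (x 0%N)), 0%N.
by move=> _ [j _ <-].
Qed.

Lemma normc_ge0 (z : C) : 0 <= normc z.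
Proof. by case: z => u v; rewrite sqrtr_ge0. Qed.

Lemma c0_normD (x y : c0) :
  (c0_norm (x + y))%:C <= (c0_norm x)%:C + (c0_norm y)%:C.
Proof.
rewrite -rmorphD lecR; apply: c0_norm_le => j.
by rewrite (le_trans (le_normcD _ _))// lerD ?c0_norm_ub.
Qed.

Lemma c0_normZ (a : C) (x : c0) :
  (c0_norm (a *: x))%:C = `|a| * (c0_norm x)%:C.
Proof.
rewrite -[`|a|]/((normc a)%:C) -rmorphM; congr (_%:C).
have le b z : c0_norm (b *: z) <= normc b * c0_norm z.
  apply: c0_norm_le => j; rewrite normcM ler_wpM2l ?c0_norm_ub//.
  exact: normc_ge0.
apply/eqP; rewrite eq_le le/=.
have [->|a0] := eqVneq a 0.
  rewrite normc0 mul0r (le_trans _ (c0_norm_ub _ 0%N))//.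
  exact: normc_ge0.
have na : 0 < normc a.
  rewrite lt_neqAle normc_ge0 andbT eq_sym; apply: contra_neq a0.
  exact: eq0_normc.
have := le a^-1 (a *: x).
by rewrite scalerA mulVf// scale1r normcV mulrC ler_pdivlMr// mulrC.
Qed.

Lemma c0_norm0_eq0 (x : c0) : (c0_norm x)%:C = 0 -> x = 0.
Proof.
move=> /complexI x0; apply/val_inj/funext => j; apply: eq0_normc.
apply/eqP; rewrite eq_le -{1}x0 c0_norm_ub/=.
exact: normc_ge0.
Qed.

HB.instance Definition _ :=
  Lmodule_isNormed.Build C c0 c0_normD c0_normZ c0_norm0_eq0.

Definition E_pred : {pred c0} :=
  fun x => `[< exists alpha : C, forall j, x j = if j == 0%N then alpha else 0 >].

Lemma E_submod_closed : submod_closed E_pred.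
Proof.
split; first by apply/asboolP; exists 0 => -[].
move=> a x y /asboolP[u xu] /asboolP[v yv]; apply/asboolP.
exists (a * u + v) => j; rewrite -[LHS]/(a * x j + y j) xu yv.
by case: j => [|j] //=; rewrite mulr0 addr0.
Qed.

HB.instance Definition _ :=
  GRing.isSubmodClosed.Build C c0 E_pred E_submod_closed.

(* The quotient module c_0 / E; its elements are the classes modulo E, see
   [q_eq] below, and its norm is the usual quotient norm. *)
Definition c0E : Type := Quotient.quot E_pred.
HB.instance Definition _ := Quotient.on c0E.
HB.instance Definition _ := GRing.Zmodule.on c0E.

Definition q : c0 -> c0E := \pi_c0E%qT.

Lemma q_eq (x y : c0) : q x = q y <-> x - y \in E_pred.
Proof.
rewrite (Quotient.idealrBE E_pred x y); split=> [xy|/eqP xy]; last exact: xy.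
by apply/eqP; exact: xy.
Qed.

Lemma q_surj (u : c0E) : exists x, q x = u.
Proof. by exists (repr u); exact: reprK. Qed.

Lemma qD (x y : c0) : q (x + y) = q x + q y.
Proof. exact: Quotient.pi_add. Qed.

Definition c0E_scale (a : C) (u : c0E) : c0E := q (a *: repr u).

Lemma qZ (a : C) (x : c0) : q (a *: x) = c0E_scale a (q x).
Proof.
apply/q_eq; rewrite -scalerBr rpredZ //; apply/q_eq.
by rewrite [RHS]reprK.
Qed.

Lemma c0E_scaleA a b u : c0E_scale a (c0E_scale b u) = c0E_scale (a * b) u.
Proof. by have [x <-] := q_surj u; rewrite -!qZ scalerA. Qed.

Lemma c0E_scale1 : left_id 1 c0E_scale.
Proof. by move=> u; have [x <-] := q_surj u; rewrite -qZ scale1r. Qed.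

Lemma c0E_scaleDr : right_distributive c0E_scale +%R.
Proof.
move=> a u v; have [x <-] := q_surj u; have [y <-] := q_surj v.
by rewrite -qD -!qZ scalerDr qD.
Qed.

Lemma c0E_scaleDl u : {morph c0E_scale^~ u : a b / a + b}.
Proof.
by move=> a b; have [x <-] := q_surj u; rewrite -!qZ scalerDl qD.
Qed.

HB.instance Definition _ := GRing.Zmodule_isLmodule.Build C c0E
  c0E_scaleA c0E_scale1 c0E_scaleDr c0E_scaleDl.

Lemma q_linear : linear q.
Proof. by move=> a x y; rewrite qD qZ. Qed.

HB.instance Definition _ := GRing.isLinear.Build C c0 c0E _ q q_linear.

Definition c0E_norm (u : c0E) : R := inf [set c0_norm x | x in q @^-1` [set u]].

Lemma c0E_norm_lb (x : c0) : c0E_norm (q x) <= c0_norm x.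
Proof.
apply: ge_inf; last by exists x.
by exists 0 => _ [y _ <-]; rewrite (le_trans _ (c0_norm_ub y 0%N))// normc_ge0.
Qed.

Lemma c0E_norm_ge (u : c0E) (M : R) :
  (forall x, q x = u -> M <= c0_norm x) -> M <= c0E_norm u.
Proof.
move=> uM; apply: lb_le_inf; last by move=> _ [x xu <-]; exact: uM.
by have [x xu] := q_surj u; exists (c0_norm x), x.
Qed.

Lemma c0E_normD (u v : c0E) :
  (c0E_norm (u + v))%:C <= (c0E_norm u)%:C + (c0E_norm v)%:C.
Proof.
rewrite -rmorphD lecR -lerBlDr; apply: c0E_norm_ge => x <-.
rewrite lerBlDr -lerBlDl; apply: c0E_norm_ge => y <-.
rewrite lerBlDl -qD (le_trans (c0E_norm_lb _))//.
by have := c0_normD x y; rewrite -rmorphD lecR.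
Qed.

Lemma c0E_normZ (a : C) (u : c0E) :
  (c0E_norm (a *: u))%:C = `|a| * (c0E_norm u)%:C.
Proof.
rewrite -[`|a|]/((normc a)%:C) -rmorphM; congr (_%:C).
have ge0 v : 0 <= c0E_norm v.
  apply: c0E_norm_ge => x _.
  exact: le_trans (normc_ge0 _) (c0_norm_ub x 0%N).
have normcZ (b : C) z : c0_norm (b *: z) = normc b * c0_norm z.
  by apply: complexI; rewrite c0_normZ rmorphM.
have npos (b : C) : b != 0 -> 0 < normc b.
  move=> b0; rewrite lt_neqAle normc_ge0 andbT eq_sym; apply: contra_neq b0.
  exact: eq0_normc.
have le (b : C) v : b != 0 -> c0E_norm (b *: v) <= normc b * c0E_norm v.
  move=> b0; rewrite mulrC -ler_pdivrMr ?npos//; apply: c0E_norm_ge => x <-.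
  rewrite ler_pdivrMr ?npos// mulrC -normcZ.
  by rewrite -[b *: q x]/(c0E_scale b (q x)) -qZ c0E_norm_lb.
have [->|a0] := eqVneq a 0.
  rewrite normc0 mul0r; apply/eqP; rewrite eq_le ge0 andbT.
  rewrite scale0r -(scale0r (q 0)) -[0 *: _]/(c0E_scale 0 (q 0)) -qZ.
  by rewrite (le_trans (c0E_norm_lb _))// normcZ normc0 mul0r.
apply/eqP; rewrite eq_le le//=.
have := le a^-1 (a *: u); rewrite invr_eq0 => /(_ a0).
by rewrite scalerA mulVf// scale1r normcV mulrC ler_pdivlMr ?npos// mulrC.
Qed.

Lemma c0E_norm0_eq0 (u : c0E) : (c0E_norm u)%:C = 0 -> u = 0.
Proof.
move=> /complexI u0; have [x xu] := q_surj u.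
have xj j : x j.+1 = 0.
  apply: eq0_normc; apply/eqP; rewrite eq_le normc_ge0 andbT.
  rewrite -[leRHS]u0; apply: c0E_norm_ge => y.
  rewrite -xu => /q_eq/asboolP[al /(_ j.+1)/= /eqP].
  by rewrite subr_eq0 => /eqP <-; exact: c0_norm_ub.
rewrite -xu -(linear0 q); apply/q_eq/asboolP; exists (x 0%N) => j.
by rewrite subr0; case: j.
Qed.

HB.instance Definition _ :=
  Lmodule_isNormed.Build C c0E c0E_normD c0E_normZ c0E_norm0_eq0.

Definition phi (lambda : C) : nat -> C^o := fun j => lambda ^+ j.

Lemma phi_c0 (lambda : C) : `|lambda| < 1 -> phi lambda \in c0_pred.
Proof.
move=> l1; apply/asboolP.
have l1' : `|normc lambda| < 1 by rewrite ger0_norm ?normc_ge0// -ltcR.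
apply: (cvgr0Pnorm_lt (V := C^o) (phi lambda)).2 => e.
rewrite ltcE/= => /andP[/eqP eI e0].
have normcX n : normc (lambda ^+ n) = normc lambda ^+ n.
  by elim: n => [|n IH]; rewrite ?expr0 ?normc1// !exprS normcM IH.
have := (cvgr0Pnorm_lt (V := R^o) _).1 (cvg_expr l1') _ e0.
move=> [N _ HN]; exists N => // n /HN/=.
rewrite ger0_norm ?exprn_ge0 ?normc_ge0// => ln.
by rewrite -[ltLHS]/((normc (lambda ^+ n))%:C) ltcE/= eI eqxx/= normcX.
Qed.

Definition S0 : set c0 := closed_convex_hull
  [set x : c0 | exists2 lambda : C, `|lambda| < 1 & c0_val x = phi lambda].

End CZero.

(* Main.v *)
Require Import Defs.
From HB Require Import structures.
From mathcomp Require Import all_boot all_order all_algebra.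
From mathcomp Require Import complex ring lra zify.
From mathcomp Require Import all_classical all_reals all_analysis.
Import Order.TTheory GRing.Theory Num.Theory.
Import numFieldNormedType.Exports.
Import ComplexField Normc.
Local Open Scope classical_set_scope.
Local Open Scope ring_scope.
Set Implicit Arguments.
Unset Strict Implicit.
Unset Printing Implicit Defensive.

(** A functional on c_0/E is a power series f with absolutely summable
coefficients and f(0) = 0; it sends the class of phi_lambda to f(lambda), so
its supremum over q(S_0) is the supremum of |f| over the disc.  An average of
points phi_lambda is the moment sequence of a probability measure, and the
pairing is the integral of f.  Since f is not constant, the supremum can only
be attained at a measure carried by a null subset of the circle on which f is
constantly equal to its maximum, say 1; membership in c_0 asks in addition
that the moments of this measure tend to zero.  The series f and the singular
measure are built together, in stages.

Stage j consists of 16^j points of the unit circle and of a polynomial F_j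
with |F_j| <= 1 - c_j/2 on the disc and F_j close to 1 - c_j at these points,
where c_j = 2^-(5j+1).

The polynomial is raised from 1 - c_j to 1 - c_(j+1) at the points by adding,
at each point zeta, a multiple of (w + ... + w^N)/N with w = z/zeta.  This
kernel is 1 at zeta, is at most 2/(N|z - zeta|) elsewhere, and its coefficients
have absolute sum 1.  The multiple is the current defect at zeta, about c_j, so
near zeta the new value stays in a disc around 1 - c_j of radius less than c_j,
and elsewhere the kernels are negligible compared with the margin c_j/2
(peak_step_sup).  The coefficient norm of the change is at most
16^j c_j = 2^-(j+1), which is summable.

The points are then replaced: around each point, 16 disjoint tiny arcs are
taken and one point is chosen in each of them (resample).  The choice is a
derandomised Chernoff bound (exists_potential_choice): with n points one can
keep all moments of order less than T within eta of their mean over the arcs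
as long as log T is at most a small multiple of eta^2 n.  Here n = 16^(j+1)
and eta = 2^(3-j), whereas the frequencies to be controlled are bounded by
2^(O(j^2)), because the length scales of a stage are only 2^(O(j)) times
smaller than those of the preceding one.  Averaging over arcs leaves the low moments unchanged and
destroys the high ones.

Consequently the moments converge uniformly, to a sequence y tending to zero
(limit_moment_small).  It lies in S_0 because it is a uniform limit of averages
of phi_(r zeta), zeta ranging over the points of a stage and r < 1 being chosen
in the gap between the low and the high frequencies (damped_moment_near).  The
limit h of the F_j satisfies |h| <= 1 on S_0, and the average of F_j over the
points of stage j is about 1 - c_j, whence h(y) = 1. *)

(** * Modulus of complex numbers *)

Section ComplexModulus.
Context {R : realType}.
Implicit Types (z w : R[i]).

Lemma normcX z n : normc (z ^+ n) = normc z ^+ n.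
Proof. by elim: n => [|n IH]; rewrite ?expr0 ?normc1// !exprS normcM IH. Qed.

Lemma normcB z w : normc (z - w) = normc (w - z).
Proof. by rewrite -normcN opprB. Qed.

Lemma le_normcB z w : normc (z - w) <= normc z + normc w.
Proof. by rewrite -(normcN w) le_normcD. Qed.

Lemma normc_real (r : R) : normc (r%:C)%C = `|r|.
Proof. by rewrite /= expr0n/= addr0 sqrtr_sqr. Qed.

Lemma normc_nat n : normc (n%:R : R[i]) = n%:R.
Proof. by rewrite -(rmorph_nat (real_complex R)) normc_real ger0_norm. Qed.

Lemma le_normc_sum I (r : seq I) (P : pred I) (F : I -> R[i]) :
  normc (\sum_(i <- r | P i) F i) <= \sum_(i <- r | P i) normc (F i).
Proof.
elim/big_rec2: _ => [|i a z _ IH]; first by rewrite normc0.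
by rewrite (le_trans (le_normcD _ _))// lerD2l.
Qed.

Lemma le_normc_triangle z w v : normc (z - v) <= normc (z - w) + normc (w - v).
Proof. by rewrite -[z - v](subrKA w) le_normcD. Qed.

Lemma le_Re_normc z : `|complex.Re z| <= normc z.
Proof.
case: z => a b /=; rewrite -sqrtr_sqr ler_wsqrtr// lerDl; exact: sqr_ge0.
Qed.

Lemma le_Im_normc z : `|complex.Im z| <= normc z.
Proof.
case: z => a b /=; rewrite -sqrtr_sqr ler_wsqrtr// lerDr; exact: sqr_ge0.
Qed.

Lemma le_normc_ReIm z : normc z <= `|complex.Re z| + `|complex.Im z|.
Proof.
case: z => a b /=; rewrite -[leRHS]ger0_norm ?addr_ge0// -sqrtr_sqr.
rewrite ler_wsqrtr// sqrrD !real_normK ?num_real// addrAC lerDl.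
by rewrite mulrn_wge0// mulr_ge0.
Qed.

Lemma Re_sum I (r : seq I) (P : pred I) (F : I -> R[i]) :
  complex.Re (\sum_(i <- r | P i) F i) = \sum_(i <- r | P i) complex.Re (F i).
Proof. by elim/big_rec2: _ => [|i a z _ <-]//; rewrite raddfD. Qed.

End ComplexModulus.

(** * Powers of unimodular numbers *)

Section Rotations.
Context {R : realType}.
Implicit Types (z w u : R[i]).

Lemma le_normc_subX z w k : normc z <= 1 -> normc w <= 1 ->
  normc (z ^+ k - w ^+ k) <= k%:R * normc (z - w).
Proof.
move=> z1 w1; elim: k => [|k IH]; first by rewrite !expr0 subrr normc0 mul0r.
have -> : z ^+ k.+1 - w ^+ k.+1 = z * (z ^+ k - w ^+ k) + (z - w) * w ^+ k.
  by rewrite !exprS; ring.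
rewrite (le_trans (le_normcD _ _))// !normcM normcX -natr1 mulrDl mul1r.
rewrite lerD//.
  by rewrite (le_trans _ IH)// ler_piMl// normc_ge0.
by rewrite ler_piMr ?normc_ge0// exprn_ile1// normc_ge0.
Qed.

Lemma le_normc_1subX u k : normc u <= 1 ->
  normc (1 - u ^+ k) <= k%:R * normc (1 - u).
Proof.
by move=> u1; rewrite -{1}(expr1n _ k) le_normc_subX// normc1.
Qed.

(** While k|1 - u| <= 1/2, the powers of u of exponent less than k stay in the
half plane of real part at least 1/2, so their sum does not cancel. *)
Lemma ge_normc_1subX u k : normc u <= 1 -> k%:R * normc (1 - u) <= 2^-1 ->
  k%:R / 2 * normc (1 - u) <= normc (1 - u ^+ k).
Proof.
move=> u1 ku; rewrite (normcB 1 (u ^+ k)) subrX1 normcM (normcB u).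
rewrite mulrC ler_wpM2l ?normc_ge0//.
have -> : k%:R / 2 = \sum_(i < k) (2^-1 : R).
  by rewrite sumr_const card_ord -[RHS]mulr_natl.
rewrite (le_trans _ (le_trans (ler_norm _) (le_Re_normc _)))// Re_sum.
apply: ler_sum => i _.
have : `|complex.Re (1 - u ^+ i)| <= 2^-1.
  rewrite (le_trans (le_Re_normc _))// (le_trans (le_normc_1subX _ u1))//.
  rewrite (le_trans _ ku)// ler_wpM2r ?normc_ge0// ler_nat.
  exact/ltnW/ltn_ord.
rewrite raddfB /= ler_norml => /andP[_]; lra.
Qed.

Lemma le_normc_geometric u n : normc u <= 1 ->
  normc (1 - u) * normc (\sum_(l < n) u ^+ l) <= 2.
Proof.
move=> u1; rewrite normcB -normcM -subrX1.
rewrite (le_trans (le_normcB _ _))// normc1 normcX.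
have : normc u ^+ n <= 1 by rewrite exprn_ile1// normc_ge0.
lra.
Qed.

Lemma exists_rotation (t : R) : 0 <= t <= 1 ->
  exists2 u : R[i], normc u = 1 & normc (1 - u) = t.
Proof.
move=> /andP[t0 t1]; pose s := Num.sqrt (1 - t ^+ 2 / 4).
have s2 : s ^+ 2 = 1 - t ^+ 2 / 4.
  rewrite sqr_sqrtr//; have : t ^+ 2 <= 1 by rewrite exprn_ile1.
  by lra.
(* The point of the circle at chord t from 1. *)
exists ((1 - t ^+ 2 / 2) +i* (t * s))%C; rewrite /normc /=.
  by rewrite -[RHS]sqrtr1; congr Num.sqrt; rewrite exprMn s2; field.
rewrite -[in RHS](ger0_norm t0) -sqrtr_sqr.
by congr Num.sqrt; rewrite sub0r sqrrN exprMn s2; field.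
Qed.

End Rotations.

(** * Sampling with exponentially many constraints *)

Section Sampling.
Context {R : realType}.

Lemma exists_le_average (L : nat) (f : 'I_L -> R) (c : R) : (0 < L)%N ->
  \sum_l f l <= L%:R * c -> exists l, f l <= c.
Proof.
move=> L0 fc; apply: contrapT => /forallNP nf.
suff : L%:R * c < \sum_l f l by rewrite ltNge fc.
rewrite mulr_natl -{1}(card_ord L) -sumr_const.
apply: ltr_sum; last first.
  by move=> l _; rewrite ltNge; apply/negP/nf.
by apply/hasP; exists (Ordinal L0); rewrite ?mem_index_enum.
Qed.

(** The method of conditional expectations: the mean over l of the last factor
is 1, so some l does not increase the sum of the products. *)
Lemma exists_potential_choice (K : finType) (J : eqType) (L : nat)
    (X : K -> J -> 'I_L -> R) (lam : R) (r : seq J) : (0 < L)%N ->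
  0 <= lam <= 1 -> (forall k b l, `|X k b l| <= 1) ->
  (forall k b, \sum_l X k b l = 0) -> uniq r ->
  exists s : J -> 'I_L,
    \sum_k \prod_(b <- r) (1 + lam * X k b (s b)) <= #|K|%:R.
Proof.
move=> L0 /andP[lam0 lam1] X1 X0; elim: r => [_|b r IH /= /andP[br /IH[s Hs]]].
  exists (fun=> Ordinal L0); rewrite (eq_bigr (fun=> 1)) ?sumr_const//.
  by move=> k _; rewrite big_nil.
pose P k := \prod_(b <- r) (1 + lam * X k b (s b)).
have [|l sl] := @exists_le_average L
    (fun l => \sum_k P k * (1 + lam * X k b l)) (\sum_k P k) L0.
  rewrite exchange_big /= mulr_sumr ler_sum// => k _.
  rewrite -mulr_sumr big_split/= -mulr_sumr X0 mulr0 addr0 sumr_const card_ord.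
  by rewrite mulrC.
exists (fun x => if x == b then l else s x).
rewrite (le_trans _ Hs)// (le_trans _ sl)// ler_sum// => k _.
rewrite big_cons eqxx mulrC ler_wpM2r//.
  by move: (X1 k b l); rewrite ler_norml => /andP[]; nra.
rewrite le_eqVlt; apply/orP; left; apply/eqP; apply: eq_big_seq => x xr.
by case: eqP => // xb; rewrite -xb xr in br.
Qed.

Lemma expR_sub_le (x : R) : - 2^-1 <= x <= 2^-1 ->
  expR (x - 2 * x ^+ 2) <= 1 + x.
Proof.
move=> /andP[x1 x2].
have p1 : 0 < 1 + x by lra.
rewrite -[leLHS]invrK -expRN -[leRHS]invrK lef_pV2 ?posrE ?invr_gt0 ?expR_gt0//.
apply: le_trans (expR_ge1Dx _); rewrite -[leLHS]mul1r ler_pdivrMr//.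
nra.
Qed.

(** A violated constraint k would make its own product, bounded below by
expR_sub_le, exceed the bound on the whole potential.  The constant 8 is that
of the choice lam = eta / 4. *)
Lemma exists_sampling (K J : finType) (L : nat)
    (X : K -> J -> 'I_L -> R) (eta : R) : (0 < L)%N ->
  0 <= eta <= 2 -> (forall k b l, `|X k b l| <= 1) ->
  (forall k b, \sum_l X k b l = 0) ->
  #|K|%:R < expR (eta ^+ 2 / 8 * #|J|%:R) ->
  exists s : J -> 'I_L,
    forall k, \sum_(b : J) X k b (s b) <= eta * #|J|%:R.
Proof.
move=> L0 /andP[eta0 eta2] X1 X0 Kn.
pose lam := eta / 4.
have lam01 : 0 <= lam <= 1 by rewrite /lam; lra.
have [s Hs] := exists_potential_choice L0 lam01 X1 X0 (index_enum_uniq J).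
exists s => k; rewrite leNgt; apply/negP => Hk.
have Xb b : - 2^-1 <= lam * X k b (s b) <= 2^-1.
  rewrite -ler_norml normrM ger0_norm; last by case/andP: lam01.
  by have := X1 k b (s b); rewrite /lam; nra.
have pos k' : 0 <= \prod_(b : J) (1 + lam * X k' b (s b)).
  apply: prodr_ge0 => b _.
  by move: (X1 k' b (s b)); rewrite ler_norml => /andP[]; nra.
have : \prod_(b : J) (1 + lam * X k b (s b)) <= #|K|%:R.
  by rewrite (le_trans _ Hs)// (bigD1 k)//= lerDl sumr_ge0.
apply/negP; rewrite -ltNge (lt_le_trans Kn)//.
apply: (@le_trans _ _
    (\prod_(b : J) expR (lam * X k b (s b) - 2 * (lam * X k b (s b)) ^+ 2))).
  rewrite -expR_sum ler_expR sumrB -mulr_sumr.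
  have : \sum_(b : J) 2 * (lam * X k b (s b)) ^+ 2 <= 2 * lam ^+ 2 * #|J|%:R.
    rewrite [leRHS](_ : _ = \sum_(b : J) 2 * lam ^+ 2).
      apply: ler_sum => b _; rewrite exprMn mulrA ler_piMr//.
        by rewrite mulr_ge0// sqr_ge0.
      by rewrite -real_normK ?num_real// exprn_ile1.
    by rewrite sumr_const mulr_natr.
  move: Hk; rewrite /lam; set S := \sum_(b : J) _; set Q := \sum_(b : J) _.
  by nra.
apply: ler_prod => b _; rewrite expR_ge0/=; exact: expR_sub_le.
Qed.

(** Four real constraints (the two signs of the real and of the imaginary part)
stand for each complex one.  Centred values have modulus at most 2, which is
why eta >= 2 costs nothing: the first stages, with too few points for the
exponential bound, fall in that case. *)
Lemma exists_complex_sampling (K J : finType) (L : nat)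
    (x : K -> J -> 'I_L -> R[i]) (eta : R) : (0 < L)%N -> 0 <= eta ->
  (forall k b l, normc (x k b l) <= 1) ->
  2 <= eta \/ (4 * #|K|)%:R < expR (eta ^+ 2 / 128 * #|J|%:R) ->
  exists s : J -> 'I_L, forall k,
    normc (\sum_b (x k b (s b) - L%:R^-1 * \sum_l x k b l)) <= eta * #|J|%:R.
Proof.
move=> L0 eta0 x1 eta_large.
pose y k b l := x k b l - L%:R^-1 * \sum_l' x k b l'.
have LR0 : (0 : R) < L%:R by rewrite ltr0n.
have y2 k b l : normc (y k b l) <= 2.
  rewrite (le_trans (le_normcB _ _))// (_ : 2 = 1 + 1)// lerD//.
  rewrite normcM normcV normc_nat ler_pdivrMl// mulr1.
  rewrite (le_trans (le_normc_sum _ _ _))//.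
  rewrite -[leRHS](_ : \sum_(l < L) 1 = _); last by rewrite sumr_const card_ord.
  exact: ler_sum.
have y0 k b : \sum_l y k b l = 0.
  rewrite sumrB sumr_const card_ord -[X in _ - X]mulr_natl mulrA divff ?mul1r ?subrr//.
  by rewrite pnatr_eq0 -lt0n.
have [eta2|eta2] := leP 2 eta.
  exists (fun=> Ordinal L0) => k; rewrite (le_trans (le_normc_sum _ _ _))//.
  rewrite -[leRHS](_ : \sum_(b : J) eta = _); last by rewrite sumr_const mulr_natr.
  by apply: ler_sum => b _; rewrite (le_trans (y2 _ _ _)).
have {}eta_large : (4 * #|K|)%:R < expR (eta ^+ 2 / 128 * #|J|%:R).
  by case: eta_large => //; rewrite leNgt eta2.
pose part (e : bool) (z : R[i]) : R := if e then complex.Re z else complex.Im z.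
have part_sum e (z : 'I_L -> R[i]) : \sum_l part e (z l) = part e (\sum_l z l).
  by case: e; rewrite /part raddf_sum.
have part_le e z : `|part e z| <= normc z.
  by case: e; [exact: le_Re_normc|exact: le_Im_normc].
have [||||s Hs] := @exists_sampling (K * (bool * bool))%type J L
    (fun ke b l => (-1) ^+ ke.2.1 * (part ke.2.2 (y ke.1 b l) / 2)) (eta / 4) L0.
- by lra.
- move=> [k [e f]] b l /=; rewrite normrMsign normrM [`|2^-1|]ger0_norm ?invr_ge0//.
  by have := part_le f (y k b l); have := y2 k b l; lra.
- move=> [k [e f]] b /=.
  by rewrite -mulr_sumr -mulr_suml part_sum y0 /part; case: f; rewrite mul0r mulr0.
- rewrite !card_prod card_bool mulnC (lt_le_trans eta_large)// ler_expR.
  by rewrite (_ : (eta / 4) ^+ 2 / 8 = eta ^+ 2 / 128)//; field.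
exists s => k; rewrite -/(y _ _ _).
rewrite (le_trans (le_normc_ReIm _))//.
have H f : `|part f (\sum_b y k b (s b))| <= eta / 2 * #|J|%:R.
  have pE : part f (\sum_b y k b (s b)) = \sum_b part f (y k b (s b)).
    by case: f; rewrite /part raddf_sum.
  have := Hs (k, (false, f)); have := Hs (k, (true, f)).
  rewrite /= expr0 expr1 -!mulr_sumr -!mulr_suml -pE.
  by set S := part _ _; rewrite ler_norml => ? ?; apply/andP; split; lra.
by have := H true; have := H false; rewrite /part; lra.
Qed.

End Sampling.

(** * Averaging kernels *)

Section PeakPolynomials.
Context {R : realType}.
Local Notation C := R[i].
Implicit Types (p q : {poly C}) (z w zeta : C).

(** The norm of absolutely summable Taylor coefficients, which dominates the
pairing with bounded sequences; all partial sums are bounded so that no degree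
appears. *)
Definition wiener_le p (B : R) := forall D, \sum_(k < D) normc p`_k <= B.

Lemma wiener_leD p q A B :
  wiener_le p A -> wiener_le q B -> wiener_le (p + q) (A + B).
Proof.
move=> pA qB D; rewrite (le_trans _ (lerD (pA D) (qB D)))// -big_split/=.
by apply: ler_sum => k _; rewrite coefD le_normcD.
Qed.

Lemma wiener_leZ p (a : C) (A B : R) :
  normc a <= A -> wiener_le p B -> wiener_le (a *: p) (A * B).
Proof.
move=> aA pB D; rewrite (eq_bigr (fun k : 'I_D => normc a * normc p`_k)).
  rewrite -mulr_sumr ler_pM ?normc_ge0//.
    by apply: sumr_ge0 => k _; exact: normc_ge0.
  exact: pB.
by move=> k _; rewrite coefZ normcM.
Qed.

Lemma wiener_le_sum (I : finType) (p : I -> {poly C}) (B : R) :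
  (forall i, wiener_le (p i) B) -> wiener_le (\sum_i p i) (#|I|%:R * B).
Proof.
move=> pB; have -> : #|I|%:R * B = \sum_(i : I) B.
  by rewrite sumr_const mulr_natl.
elim/big_ind2: _ => [|p1 A p2 B'|i _]; [|exact: wiener_leD|exact: pB].
by move=> D; rewrite big1// => k _; rewrite coef0 normc0.
Qed.

(** The average of w, w^2, ..., w^N at w = z / zeta.  The constant term is left
out because functionals on c_0/E do not see it. *)
Definition kern (N : nat) zeta : {poly C} :=
  \poly_(k < N.+1) (if k == 0%N then 0 else N%:R^-1 * zeta ^- k).

Section Kernel.
Variables (N : nat) (zeta : C).
Hypotheses (N0 : (0 < N)%N) (zeta1 : normc zeta = 1).

Let zeta0 : zeta != 0.
Proof. by apply: contra_eq_neq zeta1 => ->; rewrite normc0 eq_sym oner_eq0. Qed.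

Let NR0 : (0 : R) < N%:R. Proof. by rewrite ltr0n. Qed.

Lemma kern0 : (kern N zeta)`_0 = 0.
Proof. by rewrite coef_poly. Qed.

Lemma size_kern : (size (kern N zeta) <= N.+1)%N.
Proof. exact: size_poly. Qed.

Lemma horner_kern z :
  (kern N zeta).[z] = N%:R^-1 * \sum_(k < N) (z / zeta) ^+ k.+1.
Proof.
rewrite horner_poly big_ord_recl/= mul0r add0r mulr_sumr.
by apply: eq_bigr => k _; rewrite /bump leq0n add1n expr_div_n mulrA mulrAC.
Qed.

Lemma kern_peak : (kern N zeta).[zeta] = 1.
Proof.
rewrite horner_kern divff// (eq_bigr (fun=> 1)) => [|k _]; last by rewrite expr1n.
by rewrite sumr_const card_ord mulVf// pnatr_eq0 -lt0n.
Qed.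

Lemma kern_norm_le z : normc z <= 1 -> normc (kern N zeta).[z] <= 1.
Proof.
move=> z1; rewrite horner_kern normcM normcV normc_nat ler_pdivrMl// mulr1.
rewrite (le_trans (le_normc_sum _ _ _))//.
rewrite -[leRHS](_ : \sum_(k < N) 1 = _); last by rewrite sumr_const card_ord.
apply: ler_sum => k _; rewrite normcX normcM normcV zeta1 invr1 mulr1.
by rewrite exprn_ile1// normc_ge0.
Qed.

(** The geometric sum of w = z / zeta has modulus at most 2 / |1 - w|. *)
Lemma kern_decay z : normc z <= 1 ->
  normc (kern N zeta).[z] * normc (z - zeta) <= 2 / N%:R.
Proof.
move=> z1; rewrite horner_kern normcM normcV normc_nat -mulrA [leRHS]mulrC.
rewrite ler_wpM2l ?invr_ge0//.
have -> : z - zeta = - zeta * (1 - z / zeta) by field.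
have -> : \sum_(k < N) (z / zeta) ^+ k.+1
    = (z / zeta) * \sum_(k < N) (z / zeta) ^+ k.
  by rewrite mulr_sumr; apply: eq_bigr => k _; rewrite exprS.
have zz : normc (z / zeta) <= 1 by rewrite normcM normcV zeta1 invr1 mulr1.
rewrite !normcM normcN zeta1 mul1r -mulrA [X in _ * X]mulrC.
rewrite (le_trans _ (le_normc_geometric N zz))// ler_piMl//.
  by rewrite mulr_ge0 ?normc_ge0.
by rewrite -normcM.
Qed.

Lemma kern_lip z w : normc z <= 1 -> normc w <= 1 ->
  normc ((kern N zeta).[z] - (kern N zeta).[w]) <= N%:R * normc (z - w).
Proof.
move=> z1 w1; rewrite !horner_kern -mulrBr -sumrB normcM normcV normc_nat.
rewrite ler_pdivrMl// (le_trans (le_normc_sum _ _ _))//.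
have -> : N%:R * (N%:R * normc (z - w)) = \sum_(k < N) N%:R * normc (z - w).
  by rewrite sumr_const card_ord -[RHS]mulr_natl.
apply: ler_sum => k _.
rewrite (le_trans (le_normc_subX _ _ _)) ?normcM ?normcV ?zeta1 ?invr1 ?mulr1//.
rewrite -mulrBl normcM normcV zeta1 invr1 mulr1 ler_wpM2r ?normc_ge0//.
by rewrite ler_nat.
Qed.

Lemma kern_wiener : wiener_le (kern N zeta) 1.
Proof.
have bound k : normc (kern N zeta)`_k <= (k.-1 < N)%:R * N%:R^-1 *+ (k != 0%N).
  case: k => [|k]; first by rewrite kern0 normc0.
  rewrite coef_poly ltnS mulr1n; case: ifP => _; last by rewrite normc0 mul0r.
  by rewrite normcM !normcV normcX zeta1 expr1n invr1 mulr1 normc_nat mul1r.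
move=> D; apply: (@le_trans _ _
    (\sum_(i < D) ((i.-1 < N)%:R * N%:R^-1 *+ (i != 0%N :> nat)))).
  by apply: ler_sum => i _; exact: bound.
have -> : \sum_(i < D) ((i.-1 < N)%:R * N%:R^-1 *+ (i != 0%N :> nat) : R)
    = \sum_(i < D.-1) ((i < N)%:R * N%:R^-1).
  case: D => [|D]; first by rewrite !big_ord0.
  by rewrite big_ord_recl/= mulr0n add0r; apply: eq_bigr => i _; rewrite mulr1n.
rewrite -mulr_suml ler_pdivrMr// mul1r -natr_sum ler_nat.
suff -> : (\sum_(i < D.-1) (i < N) = minn D.-1 N)%N by exact: geq_minr.
elim: (D.-1) => [|M IH]; first by rewrite big_ord0 min0n.
by rewrite big_ord_recr/= IH; case: (ltnP M N) => MN /=; lia.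
Qed.

End Kernel.
End PeakPolynomials.

(** * Raising a polynomial at finitely many points *)

(** A bound for the total contribution of n kernels with coefficients at most
c at points at distance at least r from their peaks. *)
Definition leak {R : realType} (n N : nat) (c r : R) : R := n%:R * c * (2 / N%:R / r).

Section PeakStep.
Context {R : realType}.
Local Notation C := R[i].
Variables (I : finType) (Z : I -> C) (F : {poly C}) (N : nat).
Variables (c c' dlt d sg Lam : R).
Hypotheses (N0 : (0 < N)%N) (Z1 : forall i, normc (Z i) = 1).
Hypothesis Zsep : forall i j, i != j -> sg <= normc (Z i - Z j).
Hypothesis Fsup : forall z, normc z <= 1 -> normc F.[z] <= 1 - c / 2.
Hypothesis Flip : forall z w, normc z <= 1 -> normc w <= 1 ->
  normc (F.[z] - F.[w]) <= Lam * normc (z - w).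
Hypothesis Fpeak : forall i, normc (F.[Z i] - (1 - c)%:C%C) <= dlt * c.
Hypotheses (c01 : 0 < c <= 1) (cc' : 0 < c' <= c / 2) (d0 : 0 < d).
Hypotheses (dlt0 : 0 <= dlt) (Lam0 : 0 <= Lam) (dsg : 2 * d <= sg).

Local Notation tail := (leak #|I| N c).

Hypothesis budget : 2 * dlt * c + Lam * d + tail d <= c' / 2.

Let gap i : C := (1 - c')%:C%C - F.[Z i].

(** The coefficient of each kernel is computed from the actual value of F, so
that the error made at one step is corrected at the next instead of being
added to it. *)
Definition peak_step : {poly C} := F + \sum_i gap i *: kern N (Z i).

Let NR0 : (0 : R) < N%:R. Proof. by rewrite ltr0n. Qed.

Let tail_ge0 r : 0 < r -> 0 <= tail r.
Proof. by move=> r0; case/andP: c01 => /ltW c0 _; rewrite /leak !mulr_ge0 ?invr_ge0// ltW. Qed.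

Let Lamd0 : 0 <= Lam * d. Proof. by rewrite mulr_ge0// ltW. Qed.

Let dltc0 : 0 <= dlt * c. Proof. by case/andP: c01 => /ltW c0 _; rewrite mulr_ge0. Qed.

Let gap_le i : normc (gap i) <= c - c' + dlt * c.
Proof.
have -> : gap i = (c - c')%:C%C - (F.[Z i] - (1 - c)%:C%C).
  by rewrite /gap !rmorphB /=; ring.
rewrite (le_trans (le_normcB _ _))// lerD// normc_real ger0_norm//.
by case/andP: cc' => _; case/andP: c01; lra.
Qed.

Let gap_le_c i : normc (gap i) <= c.
Proof.
have := gap_le i; have := tail_ge0 d0; move: budget Lamd0 dltc0.
by case/andP: cc'; lra.
Qed.

Lemma horner_peak_step z :
  peak_step.[z] = F.[z] + \sum_i gap i * (kern N (Z i)).[z].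
Proof.
by rewrite hornerD horner_sum; congr (_ + _); apply: eq_bigr => i _; rewrite hornerZ.
Qed.

Let others_le (P : pred I) z r : normc z <= 1 -> 0 < r ->
  (forall i, P i -> r <= normc (z - Z i)) ->
  normc (\sum_(i | P i) gap i * (kern N (Z i)).[z]) <= tail r.
Proof.
move=> z1 r0 far; rewrite (le_trans (le_normc_sum _ _ _))//.
have c0 : 0 <= c by case/andP: c01 => /ltW.
rewrite /leak; apply: (@le_trans _ _ (\sum_(i | P i) c * (2 / N%:R / r))).
  apply: ler_sum => i Pi; rewrite normcM ler_pM ?normc_ge0//.
  rewrite ler_pdivlMr// (le_trans _ (kern_decay N (Z1 i) z1))//.
  by rewrite ler_wpM2l ?normc_ge0 ?far.
rewrite sumr_const -[leLHS]mulr_natl -[leRHS]mulrA ler_wpM2r//.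
  by rewrite !mulr_ge0 ?invr_ge0// ltW.
by rewrite ler_nat max_card.
Qed.

Let far_from_others i0 j z : normc (z - Z i0) < d -> j != i0 -> d <= normc (z - Z j).
Proof.
move=> zi0 ji0; have := Zsep ji0.
have := le_normc_triangle (Z j) z (Z i0); rewrite (normcB (Z j) z).
by move: dsg zi0; lra.
Qed.

(** If z is within d of a point, all other kernels leak little, F is about
1 - c, and the remaining kernel moves it by at most about c - c'.  If z is far
from all the points, the margin c / 2 absorbs the leak. *)
Lemma peak_step_sup z : normc z <= 1 -> normc peak_step.[z] <= 1 - c' / 2.
Proof.
move=> z1; rewrite horner_peak_step; have t0 := tail_ge0 d0.
have [[i0 zi0]|/forallNP nz] := pselect (exists i, normc (z - Z i) < d).
  rewrite (bigD1 i0)//= addrA.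
  have -> : F.[z] + gap i0 * (kern N (Z i0)).[z] =
      (1 - c)%:C%C + (F.[Z i0] - (1 - c)%:C%C) + (F.[z] - F.[Z i0])
      + gap i0 * (kern N (Z i0)).[z] by ring.
  have oth : normc (\sum_(i | i != i0) gap i * (kern N (Z i)).[z]) <= tail d.
    by apply: others_le => // i ii0; exact: far_from_others zi0 _.
  have g0 : normc (gap i0 * (kern N (Z i0)).[z]) <= c - c' + dlt * c.
    rewrite normcM (le_trans _ (gap_le i0))// ler_piMr ?normc_ge0//.
    exact: kern_norm_le.
  have l0 : normc (F.[z] - F.[Z i0]) <= Lam * d.
    by rewrite (le_trans (Flip _ _))// ?Z1// ler_wpM2l// ltW.
  have c1 : normc (1 - c)%:C%C = 1 - c.
    by rewrite normc_real ger0_norm//; case/andP: c01; lra.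
  rewrite (le_trans (le_normcD _ _))//.
  have := le_normcD ((1 - c)%:C%C + (F.[Z i0] - (1 - c)%:C%C) + (F.[z] - F.[Z i0]))
    (gap i0 * (kern N (Z i0)).[z]).
  have := le_normcD ((1 - c)%:C%C + (F.[Z i0] - (1 - c)%:C%C)) (F.[z] - F.[Z i0]).
  have := le_normcD (1 - c)%:C%C (F.[Z i0] - (1 - c)%:C%C).
  by have := Fpeak i0; move: budget; lra.
have oth : normc (\sum_i gap i * (kern N (Z i)).[z]) <= tail d.
  by apply: others_le => // i _; rewrite leNgt; apply/negP/nz.
rewrite (le_trans (le_normcD _ _))//.
by have := Fsup z1; move: budget Lamd0 dltc0; case/andP: cc'; lra.
Qed.

Lemma peak_step_lip z w : normc z <= 1 -> normc w <= 1 ->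
  normc (peak_step.[z] - peak_step.[w])
    <= (Lam + #|I|%:R * c * N%:R) * normc (z - w).
Proof.
move=> z1 w1; rewrite !horner_peak_step opprD addrACA mulrDl -sumrB.
rewrite (le_trans (le_normcD _ _))// lerD ?Flip//.
rewrite (le_trans (le_normc_sum _ _ _))//.
have -> : #|I|%:R * c * N%:R * normc (z - w)
    = \sum_(i : I) c * (N%:R * normc (z - w)).
  by rewrite sumr_const -[RHS]mulr_natl !mulrA.
apply: ler_sum => i _; rewrite -mulrBr normcM ler_pM ?normc_ge0//.
exact: kern_lip.
Qed.

Lemma peak_step_peak i :
  normc (peak_step.[Z i] - (1 - c')%:C%C) <= tail sg.
Proof.
have sg0 : 0 < sg by move: dsg d0; lra.
rewrite horner_peak_step (bigD1 i)//= kern_peak// mulr1 /gap.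
rewrite [X in normc X](_ : _ =
  \sum_(j | j != i) gap j * (kern N (Z j)).[Z i]); last by rewrite /gap; ring.
apply: others_le => //; first by rewrite Z1.
by move=> j ji; apply: Zsep; rewrite eq_sym.
Qed.

Lemma peak_step_wiener : wiener_le (peak_step - F) (#|I|%:R * c).
Proof.
rewrite /peak_step addrAC subrr add0r; apply: wiener_le_sum => i.
by rewrite -[c]mulr1; apply: wiener_leZ => //; exact: kern_wiener.
Qed.

Lemma peak_step_coef0 : peak_step`_0 = F`_0.
Proof.
rewrite /peak_step coefD coef_sum big1 ?addr0// => i _.
by rewrite coefZ kern0 mulr0.
Qed.

Lemma size_peak_step : (size F <= N.+1)%N -> (size peak_step <= N.+1)%N.
Proof.
move=> sF; rewrite (leq_trans (size_polyD _ _))// geq_max sF/=.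
apply: (leq_trans (size_sum _ _ _)); apply/bigmax_leqP => i _.
by rewrite (leq_trans (size_scale_leq _ _))// size_kern.
Qed.

End PeakStep.

(** * Replacing points of the circle by points of nearby arcs *)

Section Resampling.
Context {R : realType}.
Local Notation C := R[i].

Let eq_le1 (u : C) : normc u = 1 -> normc u <= 1. Proof. by move=> ->. Qed.

Definition moment (J : finType) (Z : J -> C) (k : nat) : C :=
  #|J|%:R^-1 * \sum_j Z j ^+ k.

Lemma moment_le1 (J : finType) (Z : J -> C) k : (0 < #|J|)%N ->
  (forall j, normc (Z j) = 1) -> normc (moment Z k) <= 1.
Proof.
move=> J0 Z1; rewrite normcM normcV normc_nat ler_pdivrMl ?ltr0n// mulr1.
rewrite (le_trans (le_normc_sum _ _ _))//.
rewrite -[leRHS](_ : \sum_(j : J) 1 = _); last by rewrite sumr_const.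
by apply: ler_sum => j _; rewrite normcX Z1 expr1n.
Qed.

(** The mean of v^t over the exponents t of m blocks of L consecutive integers,
separated by gaps of length L: this is the factor by which spreading a point
over arcs multiplies a moment. *)
Definition arcs (m L : nat) (v : C) : C :=
  m%:R^-1 * \sum_(a < m) L%:R^-1 * \sum_(l < L) v ^+ (2 * a * L + l).

Section Arcs.
Variables (m L : nat) (u : C).
Hypotheses (m0 : (0 < m)%N) (L0 : (0 < L)%N) (u1 : normc u = 1).
Let width := (2 * m * L)%:R * normc (1 - u).

Let LR0 : (0 : R) < L%:R. Proof. by rewrite ltr0n. Qed.

Let mean_le (n : nat) (f : 'I_n -> C) (B : R) : (0 < n)%N ->
  (forall i, normc (f i) <= B) -> normc (n%:R^-1 * \sum_i f i) <= B.
Proof.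
move=> n0 fB; rewrite normcM normcV normc_nat ler_pdivrMl ?ltr0n//.
rewrite (le_trans (le_normc_sum _ _ _))//.
rewrite -[leRHS](_ : \sum_(i < n) B = _); last first.
  by rewrite sumr_const card_ord -[LHS]mulr_natl.
exact: ler_sum.
Qed.

Lemma arcs_le1 k : normc (arcs m L (u ^+ k)) <= 1.
Proof.
apply: mean_le => // a; apply: mean_le => // l.
by rewrite !normcX u1 !expr1n.
Qed.

Lemma arcs_near1 k : normc (arcs m L (u ^+ k) - 1) <= k%:R * width.
Proof.
have E1 (n : nat) : (0 < n)%N -> (1 : C) = n%:R^-1 * \sum_(i < n) 1.
  by move=> n0; rewrite sumr_const card_ord mulVf// pnatr_eq0 -lt0n.
rewrite [X in _ - X](E1 m m0) -mulrBr -sumrB; apply: mean_le => // a.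
rewrite [X in _ - X](E1 L L0) -mulrBr -sumrB; apply: mean_le => // l.
rewrite normcB -exprM (le_trans (le_normc_1subX _ _)) ?u1//.
rewrite /width mulrA ler_wpM2r ?normc_ge0// -natrM ler_nat leq_mul2l.
apply/orP; right; rewrite (@leq_trans (2 * a * L + L))//.
  by rewrite leq_add2l ltnW.
by have := ltn_ord a; nia.
Qed.

(** Each block alone is a geometric sum, small once k L |1 - u| is large. *)
Lemma arcs_decay k : k%:R * normc (1 - u) <= 2^-1 ->
  k%:R * width * normc (arcs m L (u ^+ k)) <= 8 * m%:R.
Proof.
move=> ku; have lb := ge_normc_1subX (eq_le1 u1) ku.
have uk1 : normc (u ^+ k) <= 1 by rewrite normcX u1 expr1n.
have geo := le_normc_geometric L uk1.
set v := u ^+ k in uk1 geo lb *; set g := \sum_(l < L) v ^+ l in geo.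
have arcsg : normc (arcs m L v) <= L%:R^-1 * normc g.
  apply: mean_le => // a.
  have -> : \sum_(l < L) v ^+ (2 * a * L + l) = v ^+ (2 * a * L) * g.
    by rewrite mulr_sumr; apply: eq_bigr => l _; rewrite exprD.
  rewrite normcM normcV normc_nat normcM ler_wpM2l ?invr_ge0//.
  by rewrite ler_piMl ?normc_ge0// normcX exprn_ile1// normc_ge0.
have W : k%:R * width = 4 * m%:R * L%:R * (k%:R / 2 * normc (1 - u)).
  by rewrite /width !natrM; field.
rewrite W (@le_trans _ _ (4 * m%:R * L%:R * normc (1 - v) * (L%:R^-1 * normc g)))//.
  by rewrite ler_pM ?mulr_ge0 ?normc_ge0// ler_wpM2l.
have -> : 4 * m%:R * L%:R * normc (1 - v) * (L%:R^-1 * normc g)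
   = 4 * m%:R * (normc (1 - v) * normc g) by field; rewrite gt_eqF.
have -> : 8 * m%:R = 4 * m%:R * 2 :> R by ring.
by rewrite ler_wpM2l.
Qed.

End Arcs.

(** The chosen points are separated because they lie in distinct blocks, and
their moments are within eta of those of the original points multiplied by
arcs m L (u ^+ k). *)
Lemma resample (I : finType) (Z : I -> C) (m L T : nat) (u : C) (eta : R) :
  (0 < #|I|)%N -> (0 < m)%N -> (0 < L)%N ->
  (forall i, normc (Z i) = 1) -> normc u = 1 -> 0 <= eta ->
  2 <= eta \/ (4 * T)%:R < expR (eta ^+ 2 / 128 * (#|I| * m)%:R) ->
  T%:R * normc (1 - u) <= 2^-1 ->
  (2 * m * L)%:R * normc (1 - u) <= 2^-1 ->
  let width := (2 * m * L)%:R * normc (1 - u) in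
  exists Z' : I * 'I_m -> C, [/\
    forall p, normc (Z' p) = 1,
    forall p, normc (Z' p - Z p.1) <= width,
    forall p p', p.1 = p'.1 -> p != p' ->
      width / (4 * m%:R) <= normc (Z' p - Z' p') &
    forall k, (k < T)%N -> [/\
      normc (moment Z' k) <= normc (moment Z k) + eta,
      normc (moment Z' k - moment Z k) <= k%:R * width + eta &
      k%:R * width * (normc (moment Z' k) - eta) <= 8 * m%:R]].
Proof.
move=> I0 m0 L0 Z1 u1 eta0 eta_large Tu wu width.
have [||s Hs] := @exists_complex_sampling R 'I_T (I * 'I_m)%type L
    (fun k p l => (Z p.1 * u ^+ (2 * p.2 * L + l)) ^+ k) eta L0 eta0.
- by move=> k p l; rewrite normcX normcM normcX Z1 u1 !expr1n mulr1 expr1n.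
- by rewrite card_prod !card_ord.
pose Z' (p : I * 'I_m) := Z p.1 * u ^+ (2 * p.2 * L + s p).
have Z'1 p : normc (Z' p) = 1 by rewrite normcM normcX Z1 u1 expr1n mulr1.
have off (p : I * 'I_m) : (2 * p.2 * L + s p <= 2 * m * L)%N.
  by have := ltn_ord p.2; have := ltn_ord (s p); nia.
exists Z'; split=> // [p|[i a] [i' a'] /= <- neq|k kT].
- rewrite -[X in _ - X]mulr1 -mulrBr normcM Z1 mul1r normcB.
  rewrite (le_trans (le_normc_1subX _ _)) ?u1//.
  by rewrite ler_wpM2r ?normc_ge0// ler_nat.
- have aa' : a != a' by apply: contra neq => /eqP ->.
  have sep (x y : nat) : (x + L <= y)%N -> (y <= 2 * m * L)%N ->
      width / (4 * m%:R) <= normc (u ^+ x - u ^+ y).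
    move=> xy yL; have -> : u ^+ x - u ^+ y = u ^+ x * (1 - u ^+ (y - x)).
      by rewrite mulrBr mulr1 -exprD subnKC//; lia.
    rewrite normcM normcX u1 expr1n mul1r.
    rewrite (le_trans _ (ge_normc_1subX (eq_le1 u1) _))//; last first.
      rewrite (le_trans _ wu)// ler_wpM2r ?normc_ge0// ler_nat; lia.
    rewrite [leLHS](_ : _ = L%:R / 2 * normc (1 - u)); last first.
      by rewrite /width !natrM; field; rewrite pnatr_eq0 -lt0n.
    rewrite ler_wpM2r ?normc_ge0// ler_wpM2r// ler_nat; lia.
  rewrite -mulrBr normcM Z1 mul1r /=.
  have := ltn_ord (s (i, a)); have := ltn_ord (s (i, a')).
  have := off (i, a); have := off (i, a') => /=.
  move: aa'; rewrite -val_eqE /= neq_ltn => /orP[] lt ? ? ? ?.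
    by apply: sep => //; nia.
  by rewrite normcB; apply: sep => //; nia.
have mom : normc (moment Z' k - moment Z k * arcs m L (u ^+ k)) <= eta.
  have := Hs (Ordinal kT); rewrite sumrB /=.
  have nJ : (0 : R) < #|{: I * 'I_m}|%:R.
    by rewrite ltr0n card_prod card_ord muln_gt0 I0.
  rewrite mulrC -ler_pdivrMl// -(normc_nat #|{: I * 'I_m}|) -normcV -normcM.
  rewrite mulrBr; congr (normc (_ - _) <= _).
  rewrite /moment /arcs card_prod card_ord natrM invfM -!mulrA; congr (_ * _).
  rewrite [RHS]mulrCA; congr (_ * _).
  rewrite mulr_suml -(pair_bigA _ (fun i (a : 'I_m) => L%:R^-1 *
     \sum_(l < L) (Z i * u ^+ (2 * a * L + l)) ^+ k)) /=.
  apply: eq_bigr => i _; rewrite mulr_sumr; apply: eq_bigr => a _.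
  rewrite mulrCA; congr (_ * _); rewrite mulr_sumr; apply: eq_bigr => l _.
  by rewrite exprMn -!exprM mulnC.
have mle1 := moment_le1 k I0 Z1.
have ku : k%:R * normc (1 - u) <= 2^-1.
  by rewrite (le_trans _ Tu)// ler_wpM2r ?normc_ge0// ler_nat ltnW.
have momM : normc (moment Z k * arcs m L (u ^+ k)) = 
  normc (moment Z k) * normc (arcs m L (u ^+ k)) by rewrite normcM.
have tri := le_normc_triangle (moment Z' k) (moment Z k * arcs m L (u ^+ k)) 0.
rewrite !subr0 momM in tri.
have a1 := arcs_le1 m0 L0 u1 k.
have n0 := normc_ge0 (moment Z k); have an0 := normc_ge0 (arcs m L (u ^+ k)).
split.
- nra.
- rewrite (le_trans (le_normc_triangle _ (moment Z k * arcs m L (u ^+ k)) _))//.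
  rewrite addrC lerD// -[X in _ - X]mulr1 -mulrBr normcM.
  rewrite (le_trans _ (arcs_near1 m0 L0 u1 k))// ler_piMl ?normc_ge0//.
rewrite (le_trans _ (arcs_decay m0 L0 u1 ku))// ler_wpM2l//.
  by rewrite !mulr_ge0 ?normc_ge0.
nra.
Qed.

End Resampling.

(** * The stages and their scales *)

Section Stages.
Context {R : realType}.
Local Notation C := R[i].
Implicit Types (j : nat).

Local Notation h := (2^-1 : R).

(** The kernels added between stages j and j + 1 have length
2 ^ scale_exp j.+1; the increments 10 j + 35 leave room for all the losses of
one stage, each of which is a power of two with exponent linear in j. *)
Definition scale_exp j := (5 * j * j + 30 * j)%N.
(** The defect 1 - F_j at the points.  Its ratio 2^-5 is smaller than the
inverse of the factor 16 by which the number of points grows. *)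
Definition height j : R := h ^+ (5 * j + 1).
Definition separation j : R := h ^+ (scale_exp j + 5 * j + 17).
Definition arc_width j : R := h ^+ (scale_exp j.+1 + 5 * j + 16).
Definition sampling_error j : R := 8 * h ^+ j.
(** The moments of stage j are small between cutoff j and cutoff j.+1; beyond,
they are not controlled. *)
Definition cutoff j := (2 ^ (scale_exp j + 6 * j + 17))%N.

Lemma scale_expS j : scale_exp j.+1 = (scale_exp j + 10 * j + 35)%N.
Proof. by rewrite /scale_exp; lia. Qed.

Lemma leq_cutoff i j : (i <= j)%N -> (cutoff i <= cutoff j)%N.
Proof. by move=> ij; rewrite leq_exp2l// /scale_exp; nia. Qed.

Lemma ltn_cutoff j : (j < cutoff j)%N.
Proof.
by rewrite (leq_trans (ltn_expl j (isT : 1 < 2)%N))// leq_exp2l// /scale_exp; lia.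
Qed.

(** The frequencies to be controlled at stage j + 1, against the exponential of
the number of points times the square of the error. *)
Lemma cutoff_lt_double_exp j : (2 < j)%N ->
  (4 * cutoff j.+2 < 2 ^ (2 ^ (2 * j + 3)))%N.
Proof.
move=> j3; rewrite /cutoff -(expnD 2 2) ltn_exp2l//.
have -> : j = (j - 3 + 3)%N by lia.
elim: (j - 3)%N => [//|i IH].
rewrite (_ : (2 * (i.+1 + 3) + 3 = 2 + (2 * (i + 3) + 3))%N); last by lia.
by rewrite expnD; move: IH; rewrite /scale_exp; lia.
Qed.

(* Otherwise conversion tests evaluate powers of two. *)
Opaque scale_exp.

Lemma half_le a b : (b <= a)%N -> h ^+ a <= h ^+ b.
Proof. by move=> ba; rewrite ler_wiXn2l// ?invr_ge0// invf_le1// ler1n. Qed.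

Lemma half_ge0 a : 0 <= h ^+ a. Proof. by rewrite exprn_ge0. Qed.

Lemma half_gt0 a : 0 < h ^+ a. Proof. by rewrite exprn_gt0. Qed.

Lemma pow2_half a b : (2 ^ a)%:R * h ^+ (a + b) = h ^+ b.
Proof. by rewrite exprD mulrA natrX -exprMn mulfV ?expr1n ?mul1r// pnatr_eq0. Qed.

Lemma pow2_halfV a : (2 ^ a)%:R^-1 = h ^+ a.
Proof. by rewrite natrX exprVn. Qed.

Lemma half_pow2 a b : h ^+ a * (2 ^ (a + b))%:R = (2 ^ b)%:R.
Proof. by rewrite expnD natrM mulrA natrX -exprMn mulVf ?expr1n ?mul1r// pnatr_eq0. Qed.

Lemma halfV a : (h ^+ a)^-1 = (2 ^ a)%:R.
Proof. by rewrite -pow2_halfV invrK. Qed.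

Lemma halfS a : h ^+ a = 2 * h ^+ a.+1.
Proof. by rewrite exprS mulrA mulfV ?mul1r// pnatr_eq0. Qed.

Record stage := Stage {
  st_index : finType ;
  st_point : st_index -> C ;
  st_poly : {poly C} }.

Arguments st_point : clear implicits.

Record stage_inv j (S : stage) : Prop := StageInv {
  inv_card : #|st_index S| = (16 ^ j)%N ;
  inv_unit : forall i, normc (st_point S i) = 1 ;
  inv_sep : forall i i', i != i' ->
    separation j <= normc (st_point S i - st_point S i') ;
  inv_coef0 : (st_poly S)`_0 = 0 ;
  inv_size : (size (st_poly S) <= (2 ^ scale_exp j).+1)%N ;
  inv_sup : forall z, normc z <= 1 ->
    normc (st_poly S).[z] <= 1 - height j / 2 ;
  inv_lip : forall z w, normc z <= 1 -> normc w <= 1 ->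
    normc ((st_poly S).[z] - (st_poly S).[w])
      <= (2 ^ scale_exp j)%:R * normc (z - w) ;
  inv_peak : forall i,
    normc ((st_poly S).[st_point S i] - (1 - height j)%:C%C)
      <= h ^+ 9 * height j ;
  inv_moment : forall k, (cutoff j <= k < cutoff j.+1)%N ->
    normc (moment (st_point S) k) <= 4 * sampling_error j }.

Record stage_next j (S S' : stage) : Prop := StageNext {
  next_wiener : wiener_le (st_poly S' - st_poly S) (h ^+ j) ;
  next_moment : forall k, (k < cutoff j.+1)%N ->
    normc (moment (st_point S') k - moment (st_point S) k)
      <= 9 * sampling_error j }.

Definition first_stage : stage :=
  @Stage 'I_1 (fun=> 1) ((h%:C)%C *: 'X).

Lemma first_stage_inv : stage_inv 0 first_stage.
Proof.
have c0 : height 0 = h by rewrite /height muln0 add0n expr1.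
have nh : normc (h%:C)%C = h by rewrite normc_real ger0_norm ?invr_ge0.
split=> [|i|i i'||||||].
- by rewrite card_ord.
- exact: normc1.
- by rewrite !ord1 eqxx.
- by rewrite coefZ coefX mulr0.
- by rewrite (leq_trans (size_scale_leq _ _))// size_polyX.
- by move=> z z1; rewrite hornerZ hornerX normcM nh c0; lra.
- move=> z w z1 w1; rewrite !hornerZ !hornerX -mulrBr normcM nh mul1r.
  by rewrite ler_piMl ?normc_ge0// invf_le1// ler1n.
- move=> i; rewrite (_ : st_point first_stage i = 1)// hornerZ hornerX c0 mulr1 -rmorphB normc_real.
  rewrite [X in `|X|](_ : _ = 0); last by lra.
  by rewrite normr0 mulr_ge0 ?half_ge0 ?invr_ge0.
- move=> k _; rewrite (le_trans (moment_le1 _ _ _))//.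
  + by rewrite card_ord.
  + by move=> i; exact: normc1.
  + by rewrite /sampling_error expr0; lra.
Qed.

Section NextStage.
Variables (j : nat) (S : stage).
Hypothesis inv : stage_inv j S.

Let F := st_poly S.
Let Z := st_point S.
Let c := height j.
Let c' := height j.+1.
Let N := (2 ^ scale_exp j.+1)%N.
Let d := h ^+ (scale_exp j + 5 * j + 18).
Let Lam : R := (2 ^ scale_exp j)%:R.

Let N0 : (0 < N)%N. Proof. by rewrite expn_gt0. Qed.
Let d0 : 0 < d. Proof. exact: half_gt0. Qed.

Let c01 : 0 < c <= 1.
Proof. by rewrite half_gt0/= exprn_ile1// ?invr_ge0// invf_le1// ler1n. Qed.

Let cc' : 0 < c' <= c / 2.
Proof. by rewrite half_gt0/= /c' /c /height mulrC -exprS half_le//; (clear; lia). Qed.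

Let dsg : 2 * d <= separation j.
Proof. by rewrite /separation halfS -addnS. Qed.

Let LamE : Lam * d = h ^+ (5 * j + 18).
Proof. by rewrite /Lam /d -addnA pow2_half. Qed.

(* With lengths that are powers of two, the leak at distance 2^-a is again a
   power of two. *)
Let tailE a : (a <= scale_exp j.+1)%N ->
  leak #|st_index S| N c (h ^+ a) =
    h ^+ (j + (scale_exp j.+1 - a)).
Proof.
move=> aE; rewrite /leak (inv_card inv) /c /height halfV -(expnM 2 4).
rewrite (_ : (5 * j + 1 = 4 * j + (j + 1))%N); last by (clear; lia).
rewrite pow2_half /N pow2_halfV -[in h ^+ scale_exp _](subnKC aE) !exprD expr1.
rewrite natrX; set x := h ^+ a; have -> : 2 ^+ a = x^-1 by rewrite halfV natrX.
by field; rewrite gt_eqF ?half_gt0.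
Qed.

Let budget : 2 * h ^+ 9 * c + Lam * d
  + leak #|st_index S| N c d <= c' / 2.
Proof.
rewrite LamE /d tailE; last by rewrite scale_expS; (clear; lia).
have -> : c' / 2 = h ^+ (5 * j + 7).
  by rewrite /c' /height mulrC -exprS; congr (_ ^+ _); (clear; lia).
have -> : 2 * h ^+ 9 * c = h ^+ (5 * j + 9).
  rewrite -mulrA /c /height -exprD (_ : (9 + (5 * j + 1) = (5 * j + 9).+1)%N) -?halfS//.
  by (clear; lia).
have : h ^+ (5 * j + 18) <= h ^+ (5 * j + 9) by apply: half_le; (clear; lia).
have : h ^+ (j + (scale_exp j.+1 - (scale_exp j + 5 * j + 18))) <= h ^+ (5 * j + 9).
  by apply: half_le; rewrite scale_expS; (clear; lia).
have -> : h ^+ (5 * j + 7) = 4 * h ^+ (5 * j + 9).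
  by rewrite halfS [h ^+ _.+1]halfS -!addnS; ring.
have := half_ge0 (5 * j + 9); lra.
Qed.

Let F' := peak_step Z F N c'.

Let eta := sampling_error j.

Let eta0 : 0 <= eta. Proof. by rewrite /eta /sampling_error mulr_ge0 ?half_ge0. Qed.

Let eta_large : 2 <= eta \/
  (4 * cutoff j.+2)%:R < expR (eta ^+ 2 / 128 * (#|st_index S| * 16)%:R).
Proof.
have [j2|j3] := leqP j 2.
  left; rewrite /eta /sampling_error.
  have := half_le j2; rewrite !exprS expr0; lra.
right; have -> : eta ^+ 2 / 128 * (#|st_index S| * 16)%:R = (2 ^ (2 * j + 3))%:R.
  rewrite (inv_card inv) -expnSr -(expnM 2 4) /eta /sampling_error exprMn -exprM.
  rewrite (_ : (4 * j.+1 = (j * 2 + (2 * j + 3)).+1)%N); last by (clear; lia).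
  rewrite -[RHS](half_pow2 (j * 2)) expnSr natrM.
  by set x := (2 ^ _)%:R; set y := h ^+ _; field.
rewrite -[X in expR X]mulr1 expRM_natl.
apply: (@lt_le_trans _ _ (2 ^+ (2 ^ (2 * j + 3)))).
  by rewrite -natrX ltr_nat cutoff_lt_double_exp.
rewrite lerXn2r ?nnegrE ?expR_ge0//.
by rewrite (le_trans _ (expR_ge1Dx _)).
Qed.

Let massE : #|st_index S|%:R * c = h ^+ j.+1.
Proof.
rewrite (inv_card inv) /c /height -(expnM 2 4).
by rewrite (_ : (5 * j + 1 = 4 * j + j.+1)%N) ?pow2_half//; (clear; lia).
Qed.

Let F'_lip z v : normc z <= 1 -> normc v <= 1 ->
  normc (F'.[z] - F'.[v]) <= N%:R * normc (z - v).
Proof.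
move=> z1 v1; rewrite (le_trans (peak_step_lip N0 (inv_unit inv) (inv_lip inv)
  (inv_peak inv) c01 cc' d0 (half_ge0 9) (ler0n _ _) budget z1 v1))//.
rewrite ler_wpM2r ?normc_ge0// massE.
have Nh : N%:R * h ^+ j.+1 <= N%:R * h.
  by rewrite ler_wpM2l// -[leRHS]expr1 half_le.
have LN : (2 ^ scale_exp j)%:R * 2 <= N%:R :> R.
  rewrite -natrM ler_nat -expnSr leq_exp2l// scale_expS; (clear; lia).
by move: Nh LN; rewrite mulrC; lra.
Qed.

(** The step u of the arcs is taken so small, by increasing L, that all the
frequencies below the next cutoff are resolved; the total width of the arcs
does not depend on it. *)
Lemma exists_next_stage : exists S', stage_inv j.+1 S' /\ stage_next j S S'.
Proof.
pose w := arc_width j.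
have [L LE] : exists L, L = cutoff j.+2 by exists (cutoff j.+2).
have L0 : (0 < L)%N by rewrite LE expn_gt0.
have etaL := eta_large; rewrite -LE in etaL.
have w0 : 0 < w := half_gt0 _.
have wh : w <= h by rewrite -[leRHS]expr1; apply: half_le; rewrite scale_expS; (clear; lia).
have LR : (1 : R) <= L%:R by rewrite ler1n.
have [|u u1 uw] := @exists_rotation R (w / (2 * 16 * L)%:R).
  rewrite divr_ge0 ?(ltW w0) ?ler0n ?ler_pdivrMr ?ltr0n ?muln_gt0 ?L0//.
  by rewrite mul1r !natrM; lra.
have width : (2 * 16 * L)%:R * normc (1 - u) = w.
  by rewrite uw mulrC mulfVK// gt_eqF// ltr0n muln_gt0.
have nI : (0 < #|st_index S|)%N by rewrite (inv_card inv) expn_gt0.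
have Lu : L%:R * normc (1 - u) <= 2^-1.
  move: width wh; rewrite !natrM; lra.
have := @resample R (st_index S) Z 16 L L u eta nI isT L0 (inv_unit inv) u1 eta0
  etaL Lu.
rewrite width => /(_ wh) /= [Z' [Z'1 Z'near Z'sep Z'mom]].
exists (@Stage (st_index S * 'I_16)%type Z' F').
have sepw : 4 * w <= separation j.
  rewrite (_ : 4 * w = h ^+ (scale_exp j.+1 + 5 * j + 14)).
    by apply: half_le; rewrite scale_expS; (clear; lia).
  rewrite halfS [h ^+ _.+1]halfS /w /arc_width -!addnS; ring.
have sepE : separation j.+1 = w / (4 * 16%:R).
  rewrite /separation /w /arc_width.
  rewrite (_ : (scale_exp j.+1 + 5 * j.+1 + 17 = scale_exp j.+1 + 5 * j + 16 + 6)%N);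
    last by (clear; lia).
  by rewrite exprD; congr (_ * _); rewrite -natrM -pow2_halfV.
split; [split=> /=|split=> /=].
- by rewrite card_prod card_ord (inv_card inv) expnSr.
- exact: Z'1.
- move=> p p' pp'; have [same|diff] := eqVneq p.1 p'.1.
    by rewrite sepE; exact: Z'sep.
  have := inv_sep inv diff; rewrite -/Z.
  have := le_normc_triangle (Z p.1) (Z' p) (Z p'.1).
  have := le_normc_triangle (Z' p) (Z' p') (Z p'.1).
  have := Z'near p; have := Z'near p'; rewrite (normcB (Z p.1) (Z' p)) sepE.
  by move: sepw w0; lra.
- by rewrite peak_step_coef0 (inv_coef0 inv).
- apply: size_peak_step; rewrite (leq_trans (inv_size inv))// ltnS leq_exp2l//.
  by rewrite scale_expS; (clear; lia).
- move=> z z1; exact: (peak_step_sup N0 (inv_unit inv) (inv_sep inv) (inv_sup inv)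
    (inv_lip inv) (inv_peak inv) c01 cc' d0 (half_ge0 9) (ler0n _ _) dsg budget).
- exact: F'_lip.
- move=> p; rewrite (le_trans (le_normc_triangle _ F'.[Z p.1] _))//.
  have := peak_step_peak N0 (inv_unit inv) (inv_sep inv) (inv_peak inv)
    c01 cc' d0 (half_ge0 9) (ler0n _ _) dsg budget p.1.
  rewrite tailE; last by rewrite scale_expS; (clear; lia).
  have Z'1_le : normc (Z' p) <= 1 by rewrite Z'1.
  have Z1_le : normc (Z p.1) <= 1 by rewrite (inv_unit inv).
  have := F'_lip Z'1_le Z1_le.
  have : N%:R * normc (Z' p - Z p.1) <= h ^+ (5 * j + 16).
    by rewrite -(pow2_half (scale_exp j.+1)) addnA ler_wpM2l//; exact: Z'near.
  have : h ^+ (j + (scale_exp j.+1 - (scale_exp j + 5 * j + 17)))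
      <= h ^+ (5 * j + 16) by apply: half_le; rewrite scale_expS; (clear; lia).
  have -> : h ^+ 9 * height j.+1 = 2 * h ^+ (5 * j + 16).
    rewrite /height -exprD (_ : (9 + (5 * j.+1 + 1) = 5 * j + 15)%N); last by (clear; lia).
    by rewrite halfS -addnS.
  rewrite -/F' -/Z; lra.
- move=> k /andP[k1 k2]; rewrite -LE in k2; have [_ _] := Z'mom k k2.
  have etaE : sampling_error j = 2 * sampling_error j.+1.
    by rewrite /sampling_error [in LHS]halfS; ring.
  have kw : 16 * 8 * 2 ^+ j <= k%:R * w.
    apply: (@le_trans _ _ ((cutoff j.+1)%:R * w)); last first.
      by rewrite ler_wpM2r ?(ltW w0)// ler_nat.
    rewrite /cutoff /w /arc_width.
    rewrite (_ : (scale_exp j.+1 + 6 * j.+1 + 17 = (scale_exp j.+1 + 5 * j + 16) + (j + 7))%N);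
      last by (clear; lia).
    by rewrite [leRHS]mulrC half_pow2 expnD natrM natrX; lra.
  set M := normc _ => kM.
  have : 16 * 8 * 2 ^+ j * (M - eta) <= 8 * 16.
    have [Me|/ltW Me] := leP 0 (M - eta).
      by rewrite (le_trans _ kM)// ler_wpM2r.
    apply: (@le_trans _ _ 0) => //; rewrite mulr_ge0_le0// mulr_ge0// exprn_ge0//.
  have := half_gt0 j; have hj : h ^+ j * 2 ^+ j = 1.
    by rewrite -exprMn mulVf ?expr1n.
  rewrite -/M; move: etaE; rewrite /eta /sampling_error => etaE hj0 X.
  have : h ^+ j * (16 * 8 * 2 ^+ j * (M - 8 * h ^+ j)) <= h ^+ j * (8 * 16).
    by rewrite ler_wpM2l// ltW.
  rewrite [leLHS](_ : _ = 16 * 8 * (h ^+ j * 2 ^+ j) * (M - 8 * h ^+ j)); last by ring.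
  by rewrite hj; lra.
- move=> D; rewrite (le_trans (peak_step_wiener N0 (inv_unit inv) (inv_peak inv)
    c01 cc' d0 (half_ge0 9) (ler0n _ _) budget D))// massE half_le//.
- move=> k kT; have kL : (k < L)%N by rewrite LE (leq_trans kT)// leq_cutoff.
  have [m1 m2 _] := Z'mom k kL.
  have [kA|kA] := ltnP k (cutoff j).
    rewrite (le_trans m2)//.
    have kw : k%:R * w <= eta.
      apply: (@le_trans _ _ ((cutoff j)%:R * w)).
        by rewrite ler_wpM2r ?(ltW w0)// ler_nat ltnW.
      rewrite /cutoff /w /arc_width.
      rewrite (_ : (scale_exp j.+1 + 5 * j + 16 =
        (scale_exp j + 6 * j + 17) + (9 * j + 34))%N); last by rewrite scale_expS; (clear; lia).
      rewrite pow2_half; apply: (@le_trans _ _ (h ^+ j)); first by apply: half_le; (clear; lia).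
      by rewrite ler_peMl ?half_ge0// ler1n.
    by move: eta0 kw; rewrite -/eta; generalize eta => e; lra.
  have kI : (cutoff j <= k < cutoff j.+1)%N by rewrite kA.
  have := inv_moment inv kI; rewrite -/Z -/eta => mom; apply: le_trans (le_normcB _ _) _.
  by move: m1 mom eta0; generalize eta => e; lra.
Qed.

End NextStage.
End Stages.

Arguments st_point {R} _ _.

(** * Geometrically convergent sequences *)

Section Limits.
Context {R : realType}.
Local Notation C := R[i].
Local Notation h := (2^-1 : R).

Lemma half_pow_small (B e : R) : 0 < e -> exists j0, forall j, (j0 <= j)%N ->
  B * h ^+ j < e.
Proof.
move=> e0; have [B0|B0] := leP B 0.
  exists 0%N => j _; rewrite (le_lt_trans _ e0)// mulr_le0_ge0//; exact: half_ge0.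
exists (Num.Def.truncn (B / e)).+1 => j kj.
rewrite -[h ^+ j]invrK halfV ltr_pdivrMr ?ltr0n ?expn_gt0// mulrC -ltr_pdivrMr//.
rewrite (lt_le_trans (truncnS_gt _))// ler_nat (leq_trans kj)//.
exact/ltnW/ltn_expl.
Qed.

Lemma le_of_half_pow (a b B : R) : (forall j, a <= b + B * h ^+ j) -> a <= b.
Proof.
move=> H; rewrite leNgt; apply/negP => ba.
have [|j0 Hj] := @half_pow_small B (a - b); first by rewrite subr_gt0.
have := H j0; have := Hj _ (leqnn _); lra.
Qed.

Lemma eq0_of_half_pow (z : C) (B : R) :
  (forall j, normc z <= B * h ^+ j) -> z = 0.
Proof.
move=> H; apply: eq0_normc; apply/eqP; rewrite eq_le normc_ge0 andbT.
by apply: (@le_of_half_pow _ _ B) => j; rewrite add0r.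
Qed.

Lemma real_geometric_limit (x : nat -> R) (B : R) (J : nat) :
  (forall j, (J <= j)%N -> `|x j.+1 - x j| <= B * h ^+ j) ->
  exists l, forall j, (J <= j)%N -> `|l - x j| <= 2 * B * h ^+ j.
Proof.
move=> H; pose a j := x (J + j)%N - 2 * B * h ^+ (J + j).
pose b j := x (J + j)%N + 2 * B * h ^+ (J + j).
have Hn j : `|x (J + j.+1)%N - x (J + j)%N| <= B * h ^+ (J + j).
  by rewrite addnS; apply: H; exact: leq_addr.
have hS j : h ^+ (J + j) = 2 * h ^+ (J + j.+1) by rewrite addnS -halfS.
have aI j : a j <= a j.+1.
  by have := Hn j; have := hS j; rewrite /a ler_norml => -> /andP[]; lra.
have bI j : b j.+1 <= b j.
  by have := Hn j; have := hS j; rewrite /b ler_norml => -> /andP[]; lra.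
have aM i j : (i <= j)%N -> a i <= a j.
  by move/subnK <-; elim: (j - i)%N => // m IH; rewrite addSn (le_trans IH).
have bM i j : (i <= j)%N -> b j <= b i.
  by move/subnK <-; elim: (j - i)%N => // m IH; rewrite addSn (le_trans (bI _)).
have B0 : 0 <= B.
  have := le_trans (normr_ge0 _) (Hn 0%N).
  by rewrite pmulr_lge0// half_gt0.
have ab j : a j <= b j.
  have : 0 <= B * h ^+ (J + j) by rewrite mulr_ge0// half_ge0.
  by rewrite /a /b; lra.
have abij i j : a i <= b j.
  rewrite (le_trans (aM i (maxn i j) _)) ?leq_maxl//.
  by rewrite (le_trans (ab _))// bM// leq_maxr.
exists (sup (range a)) => j Jj.
have sa : has_sup (range a).
  by split; [exists (a 0%N), 0%N|exists (b 0%N) => _ [i _ <-]].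
have l1 : a (j - J)%N <= sup (range a) by apply: sup_upper_bound => //; exists (j - J)%N.
have l2 : sup (range a) <= b (j - J)%N.
  by apply: ge_sup => [|_ [i _ <-]//]; exists (a 0%N), 0%N.
move: l1 l2; rewrite /a /b subnKC// => l1 l2.
by rewrite ler_norml; apply/andP; split; lra.
Qed.

Lemma geometric_limit (z : nat -> C) (B : R) (J : nat) :
  (forall j, (J <= j)%N -> normc (z j.+1 - z j) <= B * h ^+ j) ->
  exists l, forall j, (J <= j)%N -> normc (l - z j) <= 4 * B * h ^+ j.
Proof.
move=> H.
have [|a Ha] := @real_geometric_limit (fun j => complex.Re (z j)) B J.
  by move=> j /H; rewrite -raddfB; exact/le_trans/le_Re_normc.
have [|b Hb] := @real_geometric_limit (fun j => complex.Im (z j)) B J.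
  by move=> j /H; rewrite -raddfB; exact/le_trans/le_Im_normc.
exists (a +i* b)%C => j Jj; rewrite (le_trans (le_normc_ReIm _))//.
by rewrite !raddfB /=; have := Ha _ Jj; have := Hb _ Jj; lra.
Qed.

End Limits.

(** * Limit of the moments *)

Section Construction.
Context {R : realType}.
Local Notation C := R[i].
Local Notation h := (2^-1 : R).

Fixpoint stages j : {S : @stage R | stage_inv j S} :=
  if j is i.+1 then
    let S' := cid (exists_next_stage (proj2_sig (stages i))) in
    exist _ (proj1_sig S') (proj1 (proj2_sig S'))
  else exist _ first_stage first_stage_inv.

Definition stage_at j := proj1_sig (stages j).
Definition peak_poly j := st_poly (stage_at j).
Definition stage_moment j k := moment (st_point (stage_at j)) k.

Lemma stage_atP j : stage_inv j (stage_at j).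
Proof. exact: proj2_sig. Qed.

Lemma stage_atS j : stage_next j (stage_at j) (stage_at j.+1).
Proof.
rewrite /stage_at /=.
by case: (cid (exists_next_stage (proj2_sig (stages j)))) => S' [].
Qed.

Lemma peak_poly_wiener j : wiener_le (peak_poly j) (3 - 2 * h ^+ j).
Proof.
elim: j => [|j IH].
  have coef k : normc (peak_poly 0)`_k = h *+ (k == 1%N).
    rewrite /peak_poly /stage_at coefZ coefX.
    by case: eqP => _; rewrite ?mulr0 ?normc0// mulr1 normc_real ger0_norm ?invr_ge0.
  move=> D; under eq_bigr do rewrite coef.
  case: D => [|[|D]]; rewrite ?big_ord0 ?big_ord1 ?mulr0n; try by rewrite expr0; lra.
  rewrite 2!big_ord_recl big1 ?addr0 => [|i _]; last by rewrite mulr0n.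
  by rewrite mulr0n mulr1n add0r expr0; lra.
have -> : peak_poly j.+1 = peak_poly j + (peak_poly j.+1 - peak_poly j) by ring.
have -> : 3 - 2 * h ^+ j.+1 = 3 - 2 * h ^+ j + h ^+ j by rewrite [h ^+ j]halfS; ring.
exact: wiener_leD (next_wiener (stage_atS j)).
Qed.

(** The stages that control order k are all those from some index on, so the
least of them is used as the starting point of the limit. *)
Lemma exists_limit_moment k : exists l : C, forall j, (k < cutoff j.+1)%N ->
  normc (l - stage_moment j k) <= 288 * h ^+ j.
Proof.
have ex : exists j, (k < cutoff j.+1)%N.
  by exists k; rewrite (ltn_trans (ltn_cutoff k))// ltn_exp2l// scale_expS; lia.
have [|l Hl] := @geometric_limit R (fun j => stage_moment j k) 72 (ex_minn ex).
  move=> j; case: ex_minnP => m km _ mj.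
  have kj : (k < cutoff j.+1)%N by rewrite (leq_trans km)// leq_cutoff.
  by have := next_moment (stage_atS j) kj; rewrite /sampling_error mulrA -natrM.
exists l => j kj; have := Hl j; rewrite -natrM; apply.
by case: ex_minnP => m _; exact.
Qed.

Definition limit_moment k : C := proj1_sig (cid (exists_limit_moment k)).

Lemma limit_momentP j k : (k < cutoff j.+1)%N ->
  normc (limit_moment k - stage_moment j k) <= 288 * h ^+ j.
Proof. by move=> kj; rewrite /limit_moment; case: cid => l /= ->. Qed.

Lemma limit_moment_small j k : (cutoff j <= k)%N ->
  normc (limit_moment k) <= 320 * h ^+ j.
Proof.
have small i : (cutoff i <= k < cutoff i.+1)%N -> normc (limit_moment k) <= 320 * h ^+ i.
  move=> ki; have /andP[_ /limit_momentP H] := ki.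
  have := inv_moment (stage_atP i) ki; rewrite -/(stage_moment i k) /sampling_error.
  have := le_normcD (limit_moment k - stage_moment i k) (stage_moment i k).
  by rewrite subrK; lra.
move=> jk; suff [i ji ki] : exists2 i, (j <= i)%N & (cutoff i <= k < cutoff i.+1)%N.
  by rewrite (le_trans (small _ ki))// ler_wpM2l// half_le.
have ex : exists i, (k < cutoff i)%N by exists k; exact: ltn_cutoff.
case: (ex_minnP ex) => -[|i] ki im.
  by move: ki; rewrite ltnNge (leq_trans _ jk)// leq_cutoff.
exists i; last by rewrite ki andbT leqNgt; apply/negP => /im; rewrite ltnn.
by rewrite -ltnS ltnNge; apply/negP => /leq_cutoff/(leq_trans ki); rewrite ltnNge jk.
Qed.

(** The degree of F_j does not exceed the range of the sum, which is therefore
the average of F_j over the points. *)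
Lemma peak_poly_moment j : normc (\sum_(k < (2 ^ scale_exp j).+1)
    (peak_poly j)`_k * stage_moment j k - (1 - height j)%:C%C) <= h ^+ 9 * height j.
Proof.
have inv := stage_atP j.
set I := st_index (stage_at j); set Z := st_point (stage_at j) : I -> C.
have I0 : (0 < #|I|)%N by rewrite (inv_card inv) expn_gt0.
have IR0 : #|I|%:R != 0 :> C by rewrite pnatr_eq0 -lt0n.
have -> : \sum_(k < (2 ^ scale_exp j).+1) (peak_poly j)`_k * stage_moment j k =
   #|I|%:R^-1 * \sum_i (peak_poly j).[Z i].
  rewrite /stage_moment /moment -/Z.
  under eq_bigr do rewrite mulrCA mulr_sumr.
  rewrite -mulr_sumr exchange_big /=; congr (_ * _); apply: eq_bigr => i _.
  by rewrite (horner_coef_wide _ (inv_size inv)).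
have -> : (1 - height j)%:C%C = #|I|%:R^-1 * \sum_(i : I) (1 - height j)%:C%C :> C.
  by rewrite sumr_const -[(1 - height j)%:C%C *+ _]mulr_natl mulKf.
rewrite -mulrBr -sumrB normcM normcV normc_nat ler_pdivrMl ?ltr0n//.
rewrite (le_trans (le_normc_sum _ _ _))// mulr_natl -sumr_const.
by apply: ler_sum => i _; exact: inv_peak inv i.
Qed.

End Construction.

(** * The limit functional *)

Section Functional.
Context {R : realType}.
Local Notation C := R[i].
Local Notation h := (2^-1 : R).
Implicit Types (x : c0 R).

Definition pairing (p : {poly C}) (x : nat -> C) : C :=
  \sum_(k < size p) p`_k * x k.

Lemma pairing_wide D (p : {poly C}) (x : nat -> C) : (size p <= D)%N ->
  pairing p x = \sum_(k < D) p`_k * x k.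
Proof.
move=> sD; rewrite /pairing -(big_mkord xpredT (fun k => p`_k * x k)).
rewrite -(big_mkord xpredT (fun k => p`_k * x k)) (big_cat_nat (leq0n _) sD)//=.
rewrite [X in _ + X]big_nat_cond [X in _ + X]big1 ?addr0// => k /andP[/andP[pk _] _].
by rewrite nth_default ?mul0r.
Qed.

Lemma pairingB (p r : {poly C}) (x : nat -> C) :
  pairing (p - r) x = pairing p x - pairing r x.
Proof.
pose D := maxn (size p) (size r).
rewrite (@pairing_wide D p) ?leq_maxl// (@pairing_wide D r) ?leq_maxr//.
rewrite (@pairing_wide D) ?size_polyB//; last first.
  by rewrite (leq_trans (size_polyD _ _))// size_polyN.
by rewrite -sumrB; apply: eq_bigr => k _; rewrite coefB mulrBl.
Qed.

Lemma pairing_linear (p : {poly C}) (a : C) (x y : nat -> C) :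
  pairing p (fun k => a * x k + y k) = a * pairing p x + pairing p y.
Proof.
rewrite /pairing mulr_sumr -big_split; apply: eq_bigr => k _ /=; ring.
Qed.

Lemma pairing_le (p : {poly C}) (x : nat -> C) (A B : R) : wiener_le p A ->
  (forall k, (k < size p)%N -> normc (x k) <= B) -> 0 <= B ->
  normc (pairing p x) <= A * B.
Proof.
move=> pA xB B0; rewrite (le_trans (le_normc_sum _ _ _))//.
apply: (@le_trans _ _ (\sum_(k < size p) normc p`_k * B)).
  by apply: ler_sum => k _; rewrite normcM ler_wpM2l ?normc_ge0 ?xB.
by rewrite -mulr_suml ler_wpM2r.
Qed.

Lemma c0_norm_ge0 x : 0 <= c0_norm x.
Proof. exact: le_trans (normc_ge0 _) (c0_norm_ub x 0%N). Qed.

Lemma exists_peak_value x : exists l : C, forall j,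
  normc (l - pairing (peak_poly j) x) <= 4 * c0_norm x * h ^+ j.
Proof.
have [|l Hl] := @geometric_limit R (fun j => pairing (peak_poly j) x) (c0_norm x) 0.
  move=> j _; rewrite -pairingB mulrC; apply: pairing_le => [|k _|].
  - exact: next_wiener (stage_atS j).
  - exact: c0_norm_ub.
  - exact: c0_norm_ge0.
by exists l => j; exact: Hl.
Qed.

Definition peak_functional x : C := proj1_sig (cid (exists_peak_value x)).

Lemma peak_functionalP x j :
  normc (peak_functional x - pairing (peak_poly j) x) <= 4 * c0_norm x * h ^+ j.
Proof. by rewrite /peak_functional; case: cid. Qed.

Lemma peak_functional_linear a x y :
  peak_functional (a *: x + y) = a * peak_functional x + peak_functional y.
Proof.
apply/eqP; rewrite -subr_eq0; apply/eqP.
apply: (@eq0_of_half_pow _ _ (4 * c0_norm (a *: x + y)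
  + (normc a * (4 * c0_norm x) + 4 * c0_norm y))) => j.
pose P : {poly C} := peak_poly j.
have PE : pairing P (a *: x + y) = a * pairing P x + pairing P y.
  by rewrite -pairing_linear.
have -> : peak_functional (a *: x + y) - (a * peak_functional x + peak_functional y) =
  (peak_functional (a *: x + y) - pairing P (a *: x + y))
  - (a * (peak_functional x - pairing P x) + (peak_functional y - pairing P y)).
  by rewrite PE; ring.
rewrite (le_trans (le_normcB _ _))// mulrDl lerD ?peak_functionalP//.
rewrite (le_trans (le_normcD _ _))// mulrDl lerD ?peak_functionalP//.
by rewrite normcM -mulrA ler_wpM2l ?normc_ge0 ?peak_functionalP.
Qed.

Lemma peak_functional_le x : normc (peak_functional x) <= 7 * c0_norm x.
Proof.
have := peak_functionalP x 0; rewrite expr0 mulr1.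
have := @pairing_le (peak_poly 0) x _ (c0_norm x) (peak_poly_wiener 0)
  (fun k _ => c0_norm_ub x k) (c0_norm_ge0 x).
have := le_normcD (peak_functional x - pairing (peak_poly 0) x) (pairing (peak_poly 0) x).
by rewrite subrK expr0; have := c0_norm_ge0 x; lra.
Qed.

Lemma peak_functional_E x : x \in @E_pred R -> peak_functional x = 0.
Proof.
move=> /asboolP[al xE]; apply: (@eq0_of_half_pow _ _ (4 * c0_norm x)) => j.
have <- : peak_functional x - pairing (peak_poly j) x = peak_functional x.
  rewrite [X in _ - X]big1 ?subr0// => -[[|k] kp] _ /=; rewrite xE/= ?mulr0//.
  by rewrite (inv_coef0 (stage_atP j)) mul0r.
exact: peak_functionalP.
Qed.

Lemma peak_functional_phi x (lambda : C) : normc lambda <= 1 ->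
  c0_val x = phi lambda -> normc (peak_functional x) <= 1.
Proof.
move=> l1 xl; apply: (@le_of_half_pow _ _ _ (4 * c0_norm x)) => j.
have := peak_functionalP x j.
have -> : pairing (peak_poly j) x = (peak_poly j).[lambda].
  by rewrite horner_coef /pairing xl.
have := inv_sup (stage_atP j) l1; rewrite -/(peak_poly j).
have := le_normcD (peak_functional x - (peak_poly j).[lambda]) (peak_poly j).[lambda].
rewrite subrK; have : 0 <= height j :> R by exact: half_ge0.
lra.
Qed.

Lemma limit_moment_c0 : limit_moment \in @c0_pred R.
Proof.
apply/asboolP; apply: (cvgr0Pnorm_lt (V := C^o) limit_moment).2 => e.
rewrite ltcE/= => /andP[/eqP eI e0].
have [j0 Hj] := half_pow_small 320 e0.
exists (cutoff j0) => // k /= jk.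
rewrite -[ltLHS]/((normc (limit_moment k))%:C%C) ltcE/= eI eqxx/=.
exact: le_lt_trans (limit_moment_small jk) (Hj _ (leqnn _)).
Qed.

Definition limit_point : c0 R := C0 limit_moment_c0.

(** Orders below the degree of F_j are also below the cutoff up to which the
limit moments are close to those of stage j. *)
Lemma peak_functional_limit : peak_functional limit_point = 1.
Proof.
apply/eqP; rewrite -subr_eq0; apply/eqP.
apply: (@eq0_of_half_pow _ _ (4 * c0_norm limit_point + 864 + 2)) => j.
have inv := @stage_atP R j.
have A1 := peak_functionalP limit_point j.
set P := peak_poly j in A1.
have A2 : normc (pairing P limit_point - pairing P (stage_moment j)) <= 864 * h ^+ j.
  have -> : pairing P limit_point - pairing P (stage_moment j) =
     pairing P (fun k => (-1) * stage_moment j k + limit_moment k).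
    by rewrite pairing_linear; ring.
  rewrite (_ : 864 * h ^+ j = 3 * (288 * h ^+ j)); last by ring.
  apply: pairing_le => [|k kP|].
  - move=> D'; rewrite (le_trans (peak_poly_wiener j D'))// gerBl mulr_ge0//.
  - rewrite mulN1r addrC; apply: limit_momentP.
    rewrite (leq_trans kP)// (leq_trans (inv_size inv))// ltn_exp2l//.
    by rewrite scale_expS; lia.
  - by rewrite mulr_ge0// half_ge0.
have A3 := @peak_poly_moment R j.
rewrite -(pairing_wide _ (inv_size inv)) -/P in A3.
have hj : height j <= h ^+ j :> R by apply: half_le; lia.
have hj0 : 0 <= height j :> R by exact: half_ge0.
have h9 : h ^+ 9 * height j <= height j :> R.
  by rewrite ler_piMl// -[leRHS](expr0 h) half_le.
have A4 : normc (- (height j)%:C%C) = height j :> R by rewrite normcN normc_real ger0_norm.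
have -> : peak_functional limit_point - 1 =
  (peak_functional limit_point - pairing P limit_point) +
  ((pairing P limit_point - pairing P (stage_moment j)) +
  ((pairing P (stage_moment j) - (1 - height j)%:C%C) + - (height j)%:C%C)).
  by rewrite rmorphB /=; ring.
apply: le_trans (le_normcD _ _) _; rewrite -[_ + 864 + 2]addrA mulrDl lerD//.
apply: le_trans (le_normcD _ _) _; rewrite mulrDl lerD//.
by apply: le_trans (le_normcD _ _) _; rewrite A4; lra.
Qed.

End Functional.

(** * The limit point and the closed convex hull *)

Section Hull.
Context {R : realType}.
Local Notation C := R[i].
Local Notation h := (2^-1 : R).

Lemma convex_mean (K : numFieldType) (V : lmodType K) (A : set V) (s : seq V) :
  convex_set (A : set (convex_lmodType V)) -> s != [::] ->
  (forall v, v \in s -> A v) -> A ((size s)%:R^-1 *: \sum_(v <- s) v).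
Proof.
move=> Aconv; elim: s => // x [_ _ sA|y s IH _ sA].
  by rewrite big_seq1 invr1 scale1r; apply: sA; rewrite mem_head.
have {}IH : A ((size (y :: s))%:R^-1 *: \sum_(v <- y :: s) v).
  by apply: IH => // v vs; apply: sA; rewrite in_cons vs orbT.
set n := size (y :: s) in IH *.
have n0 : (0 : K) < n%:R by rewrite ltr0n.
have n1 : (0 : K) < n.+1%:R by rewrite ltr0n.
have t0 : (0 : K) <= n.+1%:R^-1 by rewrite invr_ge0 ltW.
have t1 : n.+1%:R^-1 <= (1 : K) by rewrite invf_le1// ler1n.
have xA : A x by apply: sA; rewrite mem_head.
have := Aconv x (n%:R^-1 *: \sum_(v <- y :: s) v) (Itv01 t0 t1) (mem_set xA) (mem_set IH).
rewrite inE; congr A; rewrite /conv /= [in RHS]big_cons [RHS]scalerDr.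
congr (_ + _); rewrite scalerA -/n /unstable.onem; congr (_ *: _).
rewrite -/n (_ : (size s).+2 = n.+1)// -natr1; field.
by rewrite natr1 !gt_eqF.
Qed.

Lemma onem_pow_le (rho : R) n : 0 <= rho <= 1 ->
  (1 - rho) ^+ n * (1 + n%:R * rho) <= 1.
Proof.
move=> /andP[r0 r1]; elim: n => [|n IH]; first by rewrite expr0 mul0r addr0 mulr1.
rewrite exprSr -mulrA (le_trans _ IH)// ler_wpM2l ?exprn_ge0 ?subr_ge0//.
have : 0 <= n.+1%:R * rho ^+ 2 by rewrite mulr_ge0// sqr_ge0.
by rewrite -natr1; nra.
Qed.

Lemma onem_pow_ge (rho : R) n : 0 <= rho <= 1 -> 1 - n%:R * rho <= (1 - rho) ^+ n.
Proof.
move=> /andP[r0 r1]; elim: n => [|n IH]; first by rewrite expr0 mul0r subr0.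
rewrite exprSr (le_trans _ (ler_wpM2r _ IH)) ?subr_ge0//.
have : 0 <= n%:R * rho ^+ 2 by rewrite mulr_ge0// sqr_ge0.
by rewrite -natr1; nra.
Qed.

(** The radius is 1 - damping j: its powers are near 1 up to cutoff j and near 0
from cutoff j.+1 on. *)
Definition damping j : R := h ^+ j / (cutoff j)%:R.

Lemma damping01 j : 0 < damping j <= 1.
Proof.
rewrite /damping divr_gt0 ?half_gt0 ?ltr0n ?expn_gt0//= /cutoff pow2_halfV -exprD.
by rewrite -[leRHS](expr0 h) half_le.
Qed.

(** Below cutoff j the damping is negligible; between the two cutoffs the
moments of stage j and the limit moments are both small; beyond, the moments of
stage j are uncontrolled and the damping removes them. *)
Lemma damped_moment_near j k :
  normc (limit_moment k - ((1 - damping j)%:C%C) ^+ k * stage_moment j k : C)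
    <= 352 * h ^+ j.
Proof.
have inv := @stage_atP R j.
have /andP[/ltW d0 d1] := damping01 j.
have d01 : 0 <= damping j <= 1 by rewrite d0.
have m1 : normc (stage_moment j k : C) <= 1.
  by apply: moment_le1 (inv_unit inv); rewrite (inv_card inv) expn_gt0.
set r := 1 - damping j; have r0 : 0 <= r by rewrite subr_ge0.
have rk0 : 0 <= r ^+ k by rewrite exprn_ge0.
have rk1 : r ^+ k <= 1 by rewrite exprn_ile1// gerBl.
have nr : normc (r%:C%C ^+ k) = r ^+ k by rewrite normcX normc_real ger0_norm.
have hj := half_ge0 (R := R) j.
have [k1|k1] := ltnP k (cutoff j).
  have := limit_momentP (R := R) (leq_trans k1 (leq_cutoff (leqnSn j))).
  have rk : 1 - r ^+ k <= h ^+ j.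
    rewrite lerBlDr -lerBlDl (le_trans _ (onem_pow_ge k d01))// lerD2l lerN2.
    rewrite /damping mulrCA ler_piMr// ler_pdivrMr ?ltr0n ?expn_gt0//.
    by rewrite mul1r ler_nat ltnW.
  have -> : limit_moment k - r%:C%C ^+ k * stage_moment j k =
     (limit_moment k - stage_moment j k) + (1 - r ^+ k)%:C%C * stage_moment j k :> C.
    have -> : (1 - r ^+ k)%:C%C = 1 - r%:C%C ^+ k :> C by rewrite -rmorphXn -[RHS]rmorphB.
    by ring.
  move=> lm; rewrite (le_trans (le_normcD _ _))//.
  have : normc ((1 - r ^+ k)%:C%C * stage_moment j k : C) <= h ^+ j.
    rewrite normcM normc_real ger0_norm ?subr_ge0//.
    by rewrite (le_trans _ rk)// ler_piMr ?subr_ge0.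
  by lra.
have lm := limit_moment_small (R := R) k1.
apply: le_trans (le_normcB _ _) _; rewrite normcM nr.
have [k2|k2] := ltnP k (cutoff j.+1).
  have kk : (cutoff j <= k < cutoff j.+1)%N by rewrite k1.
  have := inv_moment inv kk; rewrite -/(stage_moment j k) /sampling_error => mk.
  have : r ^+ k * normc (stage_moment j k : C) <= normc (stage_moment j k : C).
    by rewrite ler_piMl// normc_ge0.
  by lra.
have Tr : 2 ^+ j <= k%:R * damping j.
  apply: (@le_trans _ _ ((cutoff j.+1)%:R * damping j)); last first.
    by rewrite ler_wpM2r// ler_nat.
  rewrite /damping /cutoff pow2_halfV -exprD scale_expS.
  rewrite (_ : (scale_exp j + 10 * j + 35 + 6 * j.+1 + 17 =
    (j + (scale_exp j + 6 * j + 17)) + (9 * j + 41))%N); last by clear; lia.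
  rewrite mulrC half_pow2 -natrX ler_nat leq_exp2l//; clear; lia.
have : r ^+ k <= h ^+ j.
  have := onem_pow_le k d01; rewrite -/r => rk.
  have : r ^+ k * 2 ^+ j <= 1.
    by rewrite (le_trans _ rk)// ler_wpM2l// (le_trans Tr)// lerDr.
  by rewrite -ler_pdivlMr ?exprn_gt0// mul1r -exprVn.
have : r ^+ k * normc (stage_moment j k : C) <= r ^+ k by rewrite ler_piMr.
by lra.
Qed.

Lemma limit_point_S0 : S0 (@limit_point R).
Proof.
move=> A [[Acl Aconv] AB].
have near j : exists2 y, A y & c0_norm (@limit_point R - y) <= 352 * h ^+ j.
  have inv := @stage_atP R j.
  have /andP[d0 d1] := damping01 j.
  pose I := st_index (@stage_at R j); pose Z : I -> C := st_point (stage_at j).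
  have I0 : (0 < #|I|)%N by rewrite (inv_card inv) expn_gt0.
  pose lam i : C := (1 - damping j)%:C%C * Z i.
  have lam1 i : `|lam i| < 1.
    rewrite -[`|_|]/((normc (lam i))%:C%C) -[ltRHS]/((1 : R)%:C%C) ltcR.
    rewrite normcM (inv_unit inv) mulr1 normc_real ger0_norm ?subr_ge0//.
    by rewrite gtrBl.
  pose x i : c0 R := C0 (phi_c0 (lam1 i)).
  pose s := [seq x i | i <- enum I].
  have sI : size s = #|I| by rewrite size_map -cardE.
  exists ((size s)%:R^-1 *: \sum_(v <- s) v).
    apply: convex_mean => //; first by rewrite -size_eq0 sI -lt0n.
    by move=> v /mapP[i _ ->]; apply: AB; exists (lam i).
  apply: c0_norm_le => k.
  have valsum (t : seq (c0 R)) : c0_val (\sum_(v <- t) v) k = \sum_(v <- t) c0_val v k.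
    by elim/big_rec2: _ => // v a b _ <-.
  have -> : c0_val (limit_point - (size s)%:R^-1 *: \sum_(v <- s) v) k =
     limit_moment k - (size s)%:R^-1 * c0_val (\sum_(v <- s) v) k by [].
  rewrite valsum big_map big_enum sI.
  rewrite (le_trans _ (damped_moment_near j k))// le_eqVlt; apply/orP; left.
  apply/eqP; congr (normc (_ - _)); rewrite /stage_moment /moment -/Z mulrCA.
  congr (_ * _); rewrite mulr_sumr; apply: eq_bigr => i _.
  by rewrite -[LHS]/(lam i ^+ k) exprMn.
pose y j : c0 R := s2val (cid2 (near j)).
have Hy j : A (y j) /\ c0_norm (limit_point - y j) <= 352 * h ^+ j.
  by rewrite /y; case: cid2.
apply: (@closed_cvg _ _ \oo _ y A Acl); first by near=> j; have [] := Hy j.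
apply/cvgrPdist_lt => e; rewrite ltcE/= => /andP[/eqP eI e0].
have [j0 Hj] := half_pow_small 352 e0.
exists j0 => // j /= jj0.
rewrite -[ltLHS]/((c0_norm (limit_point - y j))%:C%C) ltcE/= eI eqxx/=.
by have [_ yj] := Hy j; rewrite (le_lt_trans yj)// Hj.
Unshelve. all: by end_near.
Qed.

(** The bound holds at the points phi_lambda, and the set where it holds is
closed and convex. *)
Lemma peak_functional_S0 x : @S0 R x -> normc (peak_functional x) <= 1.
Proof.
pose A : set (c0 R) := [set x | normc (peak_functional x) <= 1].
apply: (smallest_sub (X := A)); last first.
  move=> y [lam lam1 yl]; apply: peak_functional_phi yl.
  move: lam1; rewrite -[`|_|]/((normc lam)%:C%C) -[ltRHS]/((1 : R)%:C%C) ltcR.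
  exact: ltW.
have subH (v w : c0 R) : peak_functional v - peak_functional w = peak_functional (v - w).
  have -> : v - w = (-1) *: w + v by rewrite scaleN1r addrC.
  by rewrite peak_functional_linear mulN1r addrC.
split.
  move=> y yA; apply: (@le_of_half_pow R _ _ 7) => j.
  have hj : (0 : C) < (h ^+ j)%:C%C by rewrite ltcR half_gt0.
  have [z [zA]] := yA _ (nbhsx_ballx y _ hj).
  rewrite -ball_normE /= -[ltLHS]/((c0_norm (y - z))%:C%C) ltcR => yz.
  have := peak_functional_le (y - z); rewrite -subH.
  have := le_normcD (peak_functional y - peak_functional z) (peak_functional z).
  by rewrite subrK; move: zA; rewrite /A /=; lra.
have peak0 : peak_functional (0 : c0 R) = 0 by apply: peak_functional_E; exact: rpred0.
move=> y z t; rewrite !inE /A /= => yA zA.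
have cE (w : C) (M : R) : (`|w| <= M%:C%C) = (normc w <= M) by rewrite -lecR.
rewrite -cE rmorph1; rewrite -cE rmorph1 in yA; rewrite -cE rmorph1 in zA.
have -> : peak_functional (conv t y z) =
  t%:num * peak_functional y + (1 - t%:num) * peak_functional z.
  rewrite /conv /= peak_functional_linear; congr (_ + _).
  by rewrite -[_ *: z]addr0 peak_functional_linear peak0 addr0.
have t0 : (0 : C) <= t%:num by [].
have t1 : t%:num <= (1 : C) by [].
have t2 : (0 : C) <= 1 - t%:num by rewrite subr_ge0.
apply: le_trans (ler_normD _ _) _.
rewrite !normrM (ger0_norm t0) (ger0_norm t2) -[leRHS](subrKC t%:num).
by rewrite lerD// ler_piMr.
Qed.

End Hull.

Theorem mainTheorem4 (R : realType) :
  exists (h : {linear c0E R -> (R[i])^o}) (y : c0E R),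
    [/\ continuous h,
        exists u : c0E R, h u != 0,
        (@q R @` @S0 R) y &
        (normc (h y))%:E =
          ereal_sup [set (normc (h x))%:E | x in @q R @` @S0 R]].
Proof.
pose f (u : c0E R) : (R[i])^o := peak_functional (repr u).
have fq x : f (q x) = peak_functional x.
  have xE : repr (q x) - x \in @E_pred R by apply/q_eq; exact: reprK.
  rewrite /f -[X in peak_functional X](subrK x) -[X in X + x]scale1r.
  by rewrite peak_functional_linear peak_functional_E// mulr0 add0r.
have flin : linear f.
  move=> a u v; have [x <-] := q_surj u; have [y <-] := q_surj v.
  by rewrite -q_linear !fq peak_functional_linear.
pose h : {linear c0E R -> (R[i])^o} := HB.pack f (GRing.isLinear.Build _ _ _ _ f flin).
have h1 : h (q (@limit_point R)) = 1 by rewrite -[LHS]/(f _) fq peak_functional_limit.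
exists h, (q (@limit_point R)); split.
- apply: bounded_linear_continuous; apply/linear_boundedP; near=> r => u.
  rewrite -[h u]/(f u) -[`|f u|]/((normc (f u))%:C%C).
  apply: (@le_trans _ _ (7%:R * `|u|)); last first.
    by rewrite ler_wpM2r//; near: r; apply: nbhs_pinfty_ge; rewrite realn.
  rewrite -[`|u|]/((c0E_norm u)%:C%C) -(rmorph_nat (real_complex R)) -rmorphM lecR.
  rewrite mulrC -ler_pdivrMr//; apply: c0E_norm_ge => x <-.
  by rewrite ler_pdivrMr// mulrC fq peak_functional_le.
- by exists (q (@limit_point R)); rewrite h1 oner_eq0.
- by exists (@limit_point R) => //; exact: limit_point_S0.
rewrite h1 normc1; apply/le_anti/andP; split.
  apply: ereal_sup_ubound; exists (q (@limit_point R)); last by rewrite h1 normc1.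
  by exists (@limit_point R) => //; exact: limit_point_S0.
apply: ge_ereal_sup => _ [_ [x xS <-] <-].
by rewrite lee_fin -[h _]/(f _) fq peak_functional_S0.
Unshelve. all: by end_near.
Qed.
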